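(* Let $\mathbf n=(n_1,\ldots,n_k)\in\mathbb N^k$ with $n_i\ge2$ for all $i$, and let $\mathcal H$ be a Hilbert space. Let $\mathcal M$ and $\mathcal N$ be (closed) invariant subspaces of $\bigotimes_{i=1}^kF^2(H_{n_i})\otimes\mathcal H$ which do not contain nonzero reducing subspaces of $\mathbf S\otimes I_{\mathcal H}$ and such that the defect operators $\Delta_{\mathcal M}$ and $\Delta_{\mathcal N}$ are positive and have finite ranks. Then $\mathcal M$ and $\mathcal N$ are unitarily equivalent if and only if $$\chi((\mathbf S\otimes I_{\mathcal H})|_{\mathcal M})=\chi((\mathbf S\otimes I_{\mathcal H})|_{\mathcal N}).$$
   Context: $H_{n_i}$ is an $n_i$-dimensional complex Hilbert space with orthonormal basis $e^i_1,\ldots,e^i_{n_i}$, and $F^2(H_{n_i}):=\mathbb C1\oplus\bigoplus_{p\ge1}H_{n_i}^{\otimes p}$ has orthonormal basis $e^i_\alpha:=e^i_{j_1}\otimes\cdots\otimes e^i_{j_p}$ for words $\alpha=g^i_{j_1}\cdots g^i_{j_p}$ in the unital free semigroup $\mathbb F_{n_i}^+$ on generators $g^i_1,\ldots,g^i_{n_i}$ (with $e^i_{g^i_0}:=1$ for the identity $g_0^i$); $|\alpha|$ is word length. $S_{i,j}e^i_\alpha:=e^i_{g^i_j\alpha}$ on $F^2(H_{n_i})$; $\mathbf S_{i,j}$ acts on $\bigotimes_{i=1}^kF^2(H_{n_i})$ as $S_{i,j}$ on the $i$-th factor and the identity on the others; $\mathbf S=(\mathbf S_1,\ldots,\mathbf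 S_k)$, $\mathbf S_i=(\mathbf S_{i,1},\ldots,\mathbf S_{i,n_i})$. A subspace is invariant (resp. reducing) for $\mathbf S\otimes I_{\mathcal H}$ if it is invariant (resp. reducing) for each $\mathbf S_{i,j}\otimes I_{\mathcal H}$. The defect operator of $\mathcal M$ is $\Delta_{\mathcal M}:=(id-\Phi_{\mathbf S_1\otimes I_{\mathcal H}})\circ\cdots\circ(id-\Phi_{\mathbf S_k\otimes I_{\mathcal H}})(P_{\mathcal M})$, where $\Phi_{\mathbf S_i\otimes I_{\mathcal H}}(Y):=\sum_{j}(\mathbf S_{i,j}\otimes I_{\mathcal H})Y(\mathbf S_{i,j}\otimes I_{\mathcal H})^*$ and $P_{\mathcal M}$ is the orthogonal projection onto $\mathcal M$. Invariant subspaces $\mathcal M,\mathcal N$ are unitarily equivalent if there is a unitary $U:\mathcal M\to\mathcal N$ with $U(\mathbf S_{i,j}\otimes I_{\mathcal H})|_{\mathcal M}=(\mathbf S_{i,j}\otimes I_{\mathcal H})|_{\mathcal N}U$ for all $i,j$. $(\mathbf S\otimes I_{\mathcal H})|_{\mathcal M}$ is the tuple with entries $(\mathbf S_{i,j}\otimes I_{\mathcal H})|_{\mathcal M}$. Euler characteristic: for a tuple $\mathbf T=(T_1,\ldots,T_k)$, $T_i=(T_{i,1},\ldots,T_{i,n_i})$, of bounded operators on a Hilbert space $\mathcal G$ with entries of $T_s$ commuting with entries of $T_t$ for $s\ne t$, let $\Phi_{T_i}(Y):=\sum_jT_{i,j}YT_{i,j}^*$ and $\mathbf\Delta_{\mathbf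 T}(I):=(id-\Phi_{T_1})\circ\cdots\circ(id-\Phi_{T_k})(I)$, assumed of finite rank. With $T_{i,\alpha}:=T_{i,j_1}\cdots T_{i,j_p}$ for $\alpha=g^i_{j_1}\cdots g^i_{j_p}$, $T_{i,g_0^i}:=I$, let $M_{\mathbf q}(\mathbf T):=\mathrm{span}\{T_{1,\alpha_1}\cdots T_{k,\alpha_k}h:|\alpha_i|\le q_i,\ h\in\mathbf\Delta_{\mathbf T}(I)(\mathcal G)\}$ for $\mathbf q\in\mathbb Z_+^k$. Then $$\chi(\mathbf T):=\lim_{m\to\infty}\frac{\dim M_{\mathbf q^{(m)}}(\mathbf T)}{\prod_{i=1}^k(1+n_i+\cdots+n_i^{q_i^{(m)}})}$$ for any increasing cofinal sequence $\mathbf q^{(m)}$ in $\mathbb Z_+^k$ (when all $n_i\ge2$ the limit exists and is independent of the sequence). *)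

(* Defs.v *)
From HB Require Import structures.
From mathcomp Require Import all_boot all_order all_algebra.
From mathcomp Require Import finmap complex ring.
From mathcomp Require Import all_classical all_reals topology normedtype.
From mathcomp.analysis.showcase Require summability.

Set Implicit Arguments.
Unset Strict Implicit.
Unset Printing Implicit Defensive.

Import Order.TTheory GRing.Theory Num.Theory.
Import numFieldNormedType.Exports.

Local Open Scope classical_set_scope.
Local Open Scope ring_scope.

(* The inner product is linear in its first argument. *)
HB.mixin Record NormedModule_hasDot (R : realType) H
    of NormedModule R[i] H := {
  dot : H -> H -> R[i];
  dot_linear : forall z, scalar (dot ^~ z);
  dotC : forall x y, dot x y = (dot y x)^*;
  dot_norm : forall x, dot x x = `|x| ^+ 2
}.

#[short(type="innerProductType")]
HB.structure Definition InnerProduct (R : realType) :=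
  {H of NormedModule R[i] H & NormedModule_hasDot R H}.

#[short(type="hilbertType")]
HB.structure Definition Hilbert (R : realType) :=
  {H of CompleteNormedModule R[i] H & NormedModule_hasDot R H}.

HB.factory Record Lmodule_hasDot (R : realType) H of GRing.Lmodule R[i] H := {
  dot : H -> H -> R[i];
  dot_linear : forall z, scalar (dot ^~ z);
  dotC : forall x y, dot x y = (dot y x)^*;
  dot_gt0 : forall x, x != 0 -> 0 < dot x x
}.

HB.builders Context (R : realType) H of Lmodule_hasDot R H.

Let dotDl x y z : dot (x + y) z = dot x z + dot y z.
Proof. by have := dot_linear z 1 x y; rewrite scale1r mul1r. Qed.

Let dot0l z : dot 0 z = 0.
Proof. by apply: (@addrI _ (dot 0 z)); rewrite -dotDl !addr0. Qed.

Let dotZl a x z : dot (a *: x) z = a * dot x z.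
Proof. by have := dot_linear z a x 0; rewrite addr0 dot0l addr0. Qed.

Let dotDr x y z : dot z (x + y) = dot z x + dot z y.
Proof. by rewrite dotC dotDl rmorphD /= -!dotC. Qed.

Let dotZr a x z : dot z (a *: x) = a^* * dot z x.
Proof. by rewrite dotC dotZl rmorphM /= -dotC. Qed.

Let dot_ge0 x : 0 <= dot x x.
Proof. by have [->|/dot_gt0/ltW//] := eqVneq x 0; rewrite dot0l. Qed.

Let cauchy_schwarz x y : `|dot x y| ^+ 2 <= dot x x * dot y y.
Proof.
have [->|y0] := eqVneq y 0.
  by rewrite dot0l mulr0 dotC dot0l conjC0 normr0 expr0n.
have dy := dot_gt0 y0.
have := dot_ge0 (dot y y *: x + (- dot x y) *: y).
rewrite dotDl !dotDr !dotZl !dotZr.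
have yR : (dot y y)^* = dot y y by rewrite -dotC.
rewrite yR rmorphN /= -!(dotC y x).
set a := dot x x; set b := dot y y; set c := dot x y; set d := dot y x.
have -> : `|c| ^+ 2 = c * d by rewrite normCK /c -dotC.
have -> : b * (b * a) + b * (- d * c) + (- c * (b * d) + - c * (- d * b)) =
   b * (a * b - c * d) by ring.
by rewrite pmulr_rge0// subr_ge0.
Qed.

Let norm x := sqrtC (dot x x).

Let normD x y : norm (x + y) <= norm x + norm y.
Proof.
rewrite /norm -ler_sqr ?nnegrE ?sqrtC_ge0 ?addr_ge0 ?sqrtC_ge0//.
rewrite sqrrD !sqrtCK dotDl !dotDr.
have : dot x y + dot y x <= sqrtC (dot x x) * sqrtC (dot y y) *+ 2.
  have -> : dot x y + dot y x = 'Re (dot x y) *+ 2.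
    by rewrite ReE -dotC -mulr_natr divfK ?pnatr_eq0.
  rewrite lerMn2r/=; apply: le_trans (leif_Re_Creal _) _.
  rewrite -(@ler_sqr _ `|_|) ?nnegrE ?mulr_ge0 ?sqrtC_ge0//.
  by rewrite exprMn !sqrtCK cauchy_schwarz.
set p := _ *+ 2; rewrite -(lerD2l (dot x x + dot y y)) => h.
by apply: le_trans (le_trans h _); rewrite le_eqVlt; apply/orP; left; apply/eqP; ring.
Qed.

Let normZ (a : R[i]) x : norm (a *: x) = `|a| * norm x.
Proof.
rewrite /norm dotZl dotZr mulrA -normCK sqrtCM ?nnegrE ?exprn_ge0//.
by rewrite sqrCK.
Qed.

Let norm0_eq0 x : norm x = 0 -> x = 0.
Proof.
move=> /eqP; rewrite /norm sqrtC_eq0 => /eqP h; apply/eqP.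
by apply: contraT => /dot_gt0; rewrite h ltxx.
Qed.

HB.instance Definition _ :=
  @Lmodule_isNormed.Build R[i] H norm normD normZ norm0_eq0.

Let dot_norm' (x : H) : dot x x = `|x| ^+ 2.
Proof. by rewrite /Num.norm /= sqrtCK. Qed.

HB.instance Definition _ :=
  NormedModule_hasDot.Build R H dot_linear dotC dot_norm'.

HB.end.

Local Existing Instance summability.totally_filter.

Section DotTheory.
Context (R : realType) (H : innerProductType R).
Implicit Types x y z : H.

Lemma dotDl x y z : dot (x + y) z = dot x z + dot y z.
Proof. by have := dot_linear z 1 x y; rewrite scale1r mul1r. Qed.

Lemma dot0l z : dot 0 z = 0.
Proof. by apply: (@addrI _ (dot 0 z)); rewrite -dotDl !addr0. Qed.

Lemma dotZl a x z : dot (a *: x) z = a * dot x z.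
Proof. by have := dot_linear z a x 0; rewrite !addr0 dot0l addr0. Qed.

Lemma dotDr x y z : dot z (x + y) = dot z x + dot z y.
Proof. by rewrite dotC dotDl rmorphD /= -!dotC. Qed.

Lemma dot0r z : dot z 0 = 0.
Proof. by rewrite dotC dot0l conjC0. Qed.

Lemma dotZr a x z : dot z (a *: x) = a^* * dot z x.
Proof. by rewrite dotC dotZl rmorphM /= -dotC. Qed.

Lemma normD_sqr x y : `|x + y| ^+ 2 = `|x| ^+ 2 + `|y| ^+ 2 + (dot x y + dot y x).
Proof. by rewrite -!dot_norm dotDl !dotDr; ring. Qed.

Lemma normD_sqr_le x y : `|x + y| ^+ 2 <= `|x| ^+ 2 *+ 2 + `|y| ^+ 2 *+ 2.
Proof.
have h : `|x + y| ^+ 2 + `|x - y| ^+ 2 = `|x| ^+ 2 *+ 2 + `|y| ^+ 2 *+ 2.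
  rewrite -!dot_norm -scaleN1r !dotDl !dotDr !dotZl !dotZr rmorphN1; ring.
by rewrite -h lerDl exprn_ge0.
Qed.

Let polar_ring (A : comNzRingType) (a b c d i : A) : i * i = -1 ->
  4 * c = a + c + (d + b) - (a - c + (- d + b))
    + i * (a - i * c + (i * d + b)) - i * (a + i * c + (- (i * d) + b)).
Proof.
move=> i2; have -> : 4 * c = 2 * c + 2 * d - (-1) * (2 * c - 2 * d) by ring.
by rewrite -i2; ring.
Qed.

Lemma dot_polar x y : 4 * dot x y =
  `|x + y| ^+ 2 - `|x - y| ^+ 2
    + 'i * `|x + 'i *: y| ^+ 2 - 'i * `|x - 'i *: y| ^+ 2.
Proof.
have i2 : 'i * 'i = -1 :> R[i] by rewrite -expr2 sqrCi.
have dotNl (u v : H) : dot (- u) v = - dot u v by rewrite -[- u]scaleN1r dotZl mulN1r.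
have dotNr (u v : H) : dot u (- v) = - dot u v.
  by rewrite -[- v]scaleN1r dotZr rmorphN1 mulN1r.
rewrite -!dot_norm !(dotDl, dotDr, dotNl, dotNr, dotZl, dotZr) conjCi.
rewrite !mulrA !mulrN !mulNr i2 !mulN1r !opprK.
exact: polar_ring.
Qed.

End DotTheory.

Section ComplexLimits.
Context (R : realType).

Lemma cvg_complexR (T : Type) (F : set_system T) {FF : Filter F} (r : T -> R) (a : R) :
  r @ F --> a -> (fun t => (r t)%:C%C : R[i]^o) @ F --> (a%:C%C : R[i]^o).
Proof.
move=> ra; apply/cvgrPdist_lt => e e0.
have eE : e = (complex.Re e)%:C%C by rewrite RRe_real// ger0_real// ltW.
have e0' : 0 < complex.Re e by rewrite -ltcR -eE.
near=> t; rewrite -rmorphB /= eE normc_def /= expr0n addr0 sqrtr_sqr ltcR.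
by near: t; apply: cvgr_dist_lt.
Unshelve. all: by end_near. Qed.

Lemma cvg_complexRe (T : Type) (F : set_system T) {FF : Filter F} (f : T -> R[i]^o) (a : R[i]^o) :
  f @ F --> a -> (fun t => complex.Re (f t)) @ F --> complex.Re a.
Proof.
move=> ra; apply/cvgrPdist_lt => e e0.
have e0' : 0 < e%:C%C :> R[i] by rewrite ltcR.
near=> t; rewrite -raddfB -ltcR.
apply: le_lt_trans (normc_ge_Re _) _.
by near: t; exact: (@cvgr_dist_lt _ (R[i]^o) _ F FF f a ra _ e0').
Unshelve. all: by end_near. Qed.

End ComplexLimits.

Section SquareSummable.
Context (R : realType) (I : choiceType) (H : hilbertType R).
Implicit Types (f g h : I -> H) (J : {fset I}).

Definition square_summable f :=
  exists M : R, forall J, \sum_(i <- J) `|f i| ^+ 2 <= M%:C%C.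

Definition square_summable_pred : {pred I -> H} :=
  fun f => `[< square_summable f >].

Lemma square_summable_closed : subsemimod_closed square_summable_pred.
Proof.
split; first split.
- by apply/asboolP; exists 0 => J; rewrite big1// => i _; rewrite normr0 expr0n.
- move=> f g /asboolP[M hM] /asboolP[N hN]; apply/asboolP.
  exists (M *+ 2 + N *+ 2) => J; rewrite rmorphD !rmorphMn /=.
  apply: le_trans (ler_sum _ (fun i _ => normD_sqr_le (f i) (g i))) _.
  by rewrite big_split /= !sumrMnl lerD// lerMn2r ?hM ?hN ?orbT.
- move=> a f /asboolP[M hM]; apply/asboolP.
  have /complex_realP[c cE] : `|a| ^+ 2 \is Num.real.
    by rewrite ger0_real ?exprn_ge0.
  exists (c * M) => J; rewrite (rmorphM (real_complex R)) -[_ c]cE.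
  under eq_bigr do rewrite normrZ exprMn.
  by rewrite -mulr_sumr ler_wpM2l ?exprn_ge0.
Qed.

HB.instance Definition _ :=
  GRing.isSubmodClosed.Build R[i] (I -> H) square_summable_pred
    square_summable_closed.

Record l2 := L2 { l2val :> I -> H ; _ : l2val \in square_summable_pred }.

HB.instance Definition _ := [isSub for l2val].
HB.instance Definition _ := [Choice of l2 by <:].
HB.instance Definition _ := [SubChoice_isSubLmodule of l2 by <:].

Lemma l2P (f : l2) : square_summable f.
Proof. by case: f => f /= /asboolP. Qed.

End SquareSummable.

Section NetSums.
Context (R : realType) (I : choiceType).
Local Notation C := (R[i]^o).
Local Notation psum := (@summability.partial_sum I C).
Implicit Types (x y : I -> C) (J : {fset I}).

Lemma psumE x J : psum x J = \sum_(i <- J) x i.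
Proof. by rewrite /summability.partial_sum big_seq_fsetE. Qed.

Lemma cvg_psum_ge0 x (M : R) : (forall i, 0 <= x i) ->
    (forall J, psum x J <= M%:C%C :> R[i]) ->
  exists l : R, [/\ psum x @ summability.totally --> (l%:C%C : C),
    forall J, psum x J <= l%:C%C :> R[i] & l <= M].
Proof.
move=> x0 xM; pose r J := complex.Re (psum x J).
have rE J : psum x J = (r J)%:C%C.
  by rewrite RRe_real// psumE ger0_real// sumr_ge0.
have rM J : r J <= M by rewrite -lecR -rE.
have hsup : has_sup (range r).
  by split; [exists (r fset0); exists fset0|exists M => _ [J _ <-]].
have rsup J : r J <= sup (range r) by apply: ub_le_sup; [case: hsup|exists J].
exists (sup (range r)); split.
- have -> : psum x = fun J => (r J)%:C%C by apply/funext.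
  apply: cvg_complexR; apply/cvgrPdist_lt => e e0.
  have [_ [J0 _ <-] J0e] := sup_adherent e0 hsup.
  exists J0 => // J /= J0J; rewrite ger0_norm ?subr_ge0//.
  rewrite ltrBlDr -ltrBlDl; apply: lt_le_trans J0e _.
  rewrite -lecR -!rE !psumE.
  rewrite [leRHS](big_fsetID _ (mem J0))/= ler_wpDr ?sumr_ge0//.
  rewrite le_eqVlt; apply/orP; left; apply/eqP; apply: eq_fbigl => i.
  rewrite !inE /=; apply/idP/andP => [iJ0|[]//]; split=> //.
  exact: (fsubsetP J0J).
- by move=> J; rewrite rE lecR.
- by apply: ge_sup; [case: hsup|move=> _ [J _ <-]].
Qed.

End NetSums.

Section L2Hilbert.
Context (R : realType) (I : choiceType) (H : hilbertType R).
Local Notation C := (R[i]^o).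
Local Notation psum := (@summability.partial_sum I C).
Local Notation l2 := (l2 I H).
Implicit Types (f g h : l2) (J : {fset I}).

Definition l2_dot f g : R[i] := @summability.sum I R[i] C (fun i => dot (f i) (g i)).

Let sqn f : I -> C := fun i => `|f i| ^+ 2.

Lemma l2_cvg_sqn f : cvg (psum (sqn f) @ summability.totally).
Proof.
have [M fM] := l2P f.
have [||l [fl _ _]] := @cvg_psum_ge0 R I (sqn f) M.
- by move=> i; rewrite exprn_ge0.
- by move=> J; rewrite psumE.
- by apply/cvg_ex; exists (l%:C%C).
Qed.

Lemma l2_cvg_dot f g :
  psum (fun i => dot (f i) (g i)) @ summability.totally --> (l2_dot f g : C).
Proof.
suff : cvg (psum (fun i => dot (f i) (g i)) @ summability.totally) by [].
pose p u J : C := psum (sqn u) J.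
have -> : psum (fun i => dot (f i) (g i)) = fun J => (4^-1 : R[i]) *:
    (p (f + g) J - p (f - g) J + 'i%R *: p (f + ('i : R[i]) *: g) J
      - 'i%R *: p (f - ('i : R[i]) *: g) J : C).
  apply/funext => J; apply: (@scalerI _ _ (4 : R[i])); first by rewrite pnatr_eq0.
  rewrite scalerA divff ?pnatr_eq0// scale1r /p !psumE.
  rewrite !scaler_sumr -!sumrB -!big_split -sumrB /=; apply: eq_bigr => i _.
  exact: dot_polar.
apply: is_cvgZl_tmp; apply: is_cvgB; last by apply: is_cvgZl_tmp; exact: l2_cvg_sqn.
apply: is_cvgD; last by apply: is_cvgZl_tmp; exact: l2_cvg_sqn.
by apply: is_cvgB; exact: l2_cvg_sqn.
Qed.

Lemma l2_dotE f g (l : C) :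
  psum (fun i => dot (f i) (g i)) @ summability.totally --> l -> l2_dot f g = l.
Proof. by move=> /cvg_lim; apply; exact: norm_hausdorff. Qed.

Lemma l2_dot_linear h : scalar (l2_dot ^~ h).
Proof.
move=> a f g; apply: l2_dotE.
have -> : psum (fun i => dot ((a *: f + g : l2) i) (h i)) = fun J =>
    (a *: (psum (fun i => dot (f i) (h i)) J : C) + psum (fun i => dot (g i) (h i)) J : C).
  apply/funext => J; rewrite !psumE scaler_sumr -big_split.
  by apply: eq_bigr => i _; rewrite /= dot_linear.
apply: (@cvgD _ C); last exact: l2_cvg_dot.
by apply: (@cvgZl_tmp _ C); exact: l2_cvg_dot.
Qed.

Lemma l2_dotC f g : l2_dot f g = (l2_dot g f)^*.
Proof.
apply: l2_dotE; apply/cvgrPdist_lt => e e0.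
have /(@cvgrPdist_lt _ C)/(_ e e0) gf := @l2_cvg_dot g f.
apply: filterS gf => J gf.
have -> : psum (fun i => dot (f i) (g i)) J = (psum (fun i => dot (g i) (f i)) J)^*.
  by rewrite !psumE rmorph_sum; apply: eq_bigr => i _; rewrite /= dotC.
rewrite -rmorphB norm_conjC.
exact: gf.
Qed.

Lemma l2_dot_bound f (M : R) :
  (forall J, \sum_(i <- J) `|f i| ^+ 2 <= M%:C%C) -> l2_dot f f <= M%:C%C.
Proof.
move=> fM; have [||l [fl _ lM]] := @cvg_psum_ge0 R I (sqn f) M.
- by move=> i; rewrite exprn_ge0.
- by move=> J; rewrite psumE.
rewrite (@l2_dotE f f l%:C%C) ?lecR//.
by under [X in psum X]funext do rewrite dot_norm.
Qed.

Lemma le_l2_dot f J : \sum_(i <- J) `|f i| ^+ 2 <= l2_dot f f.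
Proof.
have [M fM] := l2P f.
have [||l [fl lJ lM]] := @cvg_psum_ge0 R I (sqn f) M.
- by move=> i; rewrite exprn_ge0.
- by move=> K; rewrite psumE.
rewrite (@l2_dotE f f l%:C%C); last first.
  by under [X in psum X]funext do rewrite dot_norm.
by rewrite -(psumE (sqn f)).
Qed.

Lemma l2_dot_gt0 f : f != 0 -> 0 < l2_dot f f.
Proof.
move=> f0; have [i fi0] : exists i, f i != 0.
  apply: contrapT => /forallNP fi0; move/eqP: f0; apply; apply/val_inj/funext => i.
  by apply/eqP; rewrite -[_ == _]negbK; apply/negP/fi0.
apply: lt_le_trans (le_l2_dot f [fset i]%fset).
by rewrite big_seq_fset1 exprn_gt0// normr_gt0.
Qed.

HB.instance Definition _ := Lmodule_hasDot.Build R l2 l2_dot_linear l2_dotC l2_dot_gt0.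

Lemma l2_norm_bound f (M : R) : 0 <= M ->
  (forall J, \sum_(i <- J) `|f i| ^+ 2 <= (M ^+ 2)%:C%C) -> `|f| <= M%:C%C.
Proof.
move=> M0 fM; rewrite -ler_sqr ?nnegrE ?lecR// -dot_norm.
by rewrite -rmorphXn; apply: l2_dot_bound.
Qed.

Lemma le_l2_sqr_norm f J : \sum_(i <- J) `|f i| ^+ 2 <= `|f| ^+ 2.
Proof. by rewrite -dot_norm; exact: le_l2_dot. Qed.

Lemma le_l2_norm f i : `|f i| <= `|f|.
Proof.
rewrite -ler_sqr ?nnegrE//; apply: le_trans (le_l2_sqr_norm f [fset i]%fset).
by rewrite big_seq_fset1.
Qed.

End L2Hilbert.

Lemma cvg_seq_sum (K : numFieldType) (V : normedModType K) (I T : Type)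
    (F : set_system T) (FF : Filter F) (a : I -> T -> V) (b : I -> V) (s : seq I) :
  (forall i, a i @ F --> b i) ->
  (fun t => \sum_(i <- s) a i t) @ F --> \sum_(i <- s) b i.
Proof.
move=> ab; elim: s => [|i s IHs].
  by rewrite big_nil; under eq_fun do rewrite big_nil; exact: cvg_cst.
rewrite big_cons; under eq_fun do rewrite big_cons.
exact: (cvgD (ab i) IHs).
Qed.

Lemma cvg_sqr (K : numFieldType) (T : Type)
    (F : set_system T) (FF : Filter F) (a : T -> K^o) (b : K^o) :
  a @ F --> b -> (fun t => (a t) ^+ 2 : K^o) @ F --> (b ^+ 2 : K^o).
Proof.
by move=> ab; rewrite expr2; under eq_fun do rewrite expr2; exact: cvgM.
Qed.

Section L2Complete.
Context (R : realType) (I : choiceType) (H : hilbertType R).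
Local Notation C := (R[i]^o).
Local Notation l2 := (l2 I H).
Implicit Types (f g h : l2) (J : {fset I}).

Lemma l2_complete (F : set_system l2) : ProperFilter F -> cauchy F -> cvg F.
Proof.
move=> FF /cauchy_ballP Fc.
have Fsmall (e : R) : 0 < e -> exists2 A, F A &
    forall f h, A f -> A h -> `|f - h| < e%:C%C.
  move=> e0; have e0' : 0 < e%:C%C :> R[i] by rewrite ltcR.
  have [[A B] [/= FA FB] AB] := Fc _ e0'.
  exists (A `&` B) => [|f h [Af _] [_ Bh]]; first exact: filterI.
  by have := AB (f, h) (conj Af Bh); rewrite /= -ball_normE.
have ev i : cvg ((fun f : l2 => f i) @ F).
  apply: cauchy_cvg; apply/cauchy_ballP => e e0.
  have eE : e = (complex.Re e)%:C%C by rewrite RRe_real// ger0_real// ltW.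
  have [|A FA Ae] := Fsmall (complex.Re e); first by rewrite -ltcR -eE.
  exists ((fun f : l2 => f i) @` A, (fun f : l2 => f i) @` A).
    by split; apply: (@filterS _ F _ A) => // f Af /=; exists f.
  move=> [_ _] [/= [f Af <-] [h Ah <-]]; rewrite -ball_normE /= eE.
  by apply: le_lt_trans (le_l2_norm (f - h) i) _; exact: Ae.
pose g i : H := lim ((fun f : l2 => f i) @ F).
have Fg i : (fun f : l2 => f i) @ F --> g i by exact: ev.
have close (e : R) A f : F A -> (forall f h, A f -> A h -> `|f - h| < e%:C%C) ->
    A f -> forall J, \sum_(i <- J) `|f i - g i| ^+ 2 <= (e ^+ 2)%:C%C.
  move=> FA Ae Af J.
  have cv : (fun h : l2 => \sum_(i <- J) `|f i - h i| ^+ 2 : C) @ F -->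
      (\sum_(i <- J) `|f i - g i| ^+ 2 : C).
    apply: (@cvg_seq_sum R[i] C _ _ F FF) => i.
    apply: (@cvg_sqr R[i] _ F FF); apply: cvg_norm.
    by apply: cvgB; [exact: cvg_cst|exact: Fg].
  have := @cvg_complexRe R _ F _ _ _ cv; move=> /(_ FF) cvR.
  have sR (h : I -> H) : \sum_(i <- J) `|f i - h i| ^+ 2 \is @Num.real R[i].
    by rewrite ger0_real// sumr_ge0// => i _; rewrite exprn_ge0.
  rewrite -(RRe_real (sR g)) lecR.
  apply: (@cvgr_to_le _ F FF R _ _ _ cvR).
  apply: filterS FA => h Ah; rewrite -lecR RRe_real// rmorphXn /=.
  apply: le_trans (le_l2_sqr_norm (f - h) J) _.
  have e0 : 0 <= e%:C%C :> R[i] by apply/ltW/(le_lt_trans _ (Ae _ _ Af Ah)).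
  by rewrite ler_sqr ?nnegrE// ltW// Ae.
have g_l2 : g \in @square_summable_pred R I H.
  have [A FA Ae] := Fsmall 1 ltr01.
  have [f Af] := filter_ex FA.
  have -> : g = (f : I -> H) - (fun i => f i - g i).
    by apply/funext => i; rewrite !fctE subKr.
  apply: rpredB; first by case: (f).
  apply/asboolP; exists (1 ^+ 2) => J; exact: close Af J.
apply/cvg_ex; exists (L2 g_l2); apply/(@cvgrPdist_le _ l2) => e e0.
have eE : e = (complex.Re e)%:C%C by rewrite RRe_real// ger0_real// ltW.
have e0' : 0 < complex.Re e by rewrite -ltcR -eE.
have [A FA Ae] := Fsmall _ e0'.
apply: filterS (FA) => f Af; rewrite distrC eE.
apply: l2_norm_bound; first exact: ltW.
exact: close FA Ae Af.
Qed.

HB.instance Definition _ := Uniform_isComplete.Build l2 l2_complete.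

End L2Complete.

Section Subspaces.
Context (R : realType) (H : hilbertType R).

Definition is_subspace (V : set H) :=
  V 0 /\ forall (a : R[i]) x y, V x -> V y -> V (a *: x + y).

Definition lspan (A : set H) : set H := smallest is_subspace A.

Definition has_dim (V : set H) (d : nat) := exists b : 'I_d -> H,
  (forall c : 'I_d -> R[i], \sum_i c i *: b i = 0 -> forall i, c i = 0) /\
  V = range (fun c : 'I_d -> R[i] => \sum_i c i *: b i).

(* Junk value 0 if [V] is not a finite-dimensional subspace. *)
Definition lin_dim (V : set H) : nat := xget 0%N [set d | has_dim V d].

Record closed_subspace := ClosedSubspace {
  carrier :> set H;
  carrier_subspace : is_subspace carrier;
  carrier_closed : closed carrier
}.

Definition carrier_pred (M : closed_subspace) : {pred H} :=
  fun x => `[< carrier M x >].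

Lemma carrier_pred_closed M : subsemimod_closed (carrier_pred M).
Proof.
have [M0 Mlin] := carrier_subspace M.
split; first split.
- exact/asboolP.
- move=> x y /asboolP Mx /asboolP My; apply/asboolP.
  by rewrite -[x](scale1r (x : H)); exact: Mlin.
- move=> a x /asboolP Mx; apply/asboolP.
  by rewrite -[_ *: _]addr0; exact: Mlin.
Qed.

End Subspaces.

HB.instance Definition _ (R : realType) (H : hilbertType R) (M : closed_subspace H) :=
  GRing.isSubmodClosed.Build R[i] H (carrier_pred M) (carrier_pred_closed M).

Section SubspaceHilbert.
Context (R : realType) (H : hilbertType R) (M : closed_subspace H).

(* A closed subspace as a Hilbert space in its own right. *)
Record subspace_type := SubspaceVec {
  subspace_val : H; _ : subspace_val \in carrier_pred M }.

HB.instance Definition _ := [isSub for subspace_val].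
HB.instance Definition _ := [Choice of subspace_type by <:].
HB.instance Definition _ := [SubChoice_isSubLmodule of subspace_type by <:].

Lemma subspace_valP (x : subspace_type) : carrier M (val x).
Proof. by case: x => x /= /asboolP. Qed.

Definition subspace_vec (x : H) (Mx : carrier M x) : subspace_type :=
  SubspaceVec (asboolT Mx).

Definition subspace_dot (x y : subspace_type) : R[i] := dot (val x) (val y).

Lemma subspace_dot_linear z : scalar (subspace_dot ^~ z).
Proof. by move=> a x y; rewrite /subspace_dot linearP dot_linear. Qed.

Lemma subspace_dotC x y : subspace_dot x y = (subspace_dot y x)^*.
Proof. exact: dotC. Qed.

Lemma subspace_dot_gt0 x : x != 0 -> 0 < subspace_dot x x.
Proof.
move=> x0; rewrite /subspace_dot dot_norm exprn_gt0// normr_gt0.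
by apply: contra_neq x0 => x0; apply: val_inj; rewrite x0 raddf0.
Qed.

HB.instance Definition _ := Lmodule_hasDot.Build R subspace_type
  subspace_dot_linear subspace_dotC subspace_dot_gt0.

Lemma subspace_norm (x : subspace_type) : `|val x| = `|x|.
Proof.
by apply/eqP; rewrite -(@eqrXn2 _ 2)// -!dot_norm.
Qed.

Lemma subspace_complete (F : set_system subspace_type) :
  ProperFilter F -> cauchy F -> cvg F.
Proof.
move=> FF /cauchy_ballP Fc.
have Vc : cvg ((val : subspace_type -> H) @ F).
  apply: cauchy_cvg; apply/cauchy_ballP => e e0.
  have [[A B] [/= FA FB] AB] := Fc _ e0.
  exists ((val : subspace_type -> H) @` A, (val : subspace_type -> H) @` B).
    by split; [apply: (@filterS _ F _ A)|apply: (@filterS _ F _ B)] => // x Ax;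
      exists x.
  move=> [_ _] [/= [x Ax <-] [y By <-]].
  have := AB (x, y) (conj Ax By); rewrite /= -!ball_normE /=.
  by rewrite -subspace_norm raddfB.
have [y Fy] := (cvg_ex _).1 Vc.
have My : carrier M y.
  refine (@closed_cvg _ H F FF (val : subspace_type -> H) (carrier M) (@carrier_closed _ _ M) _ y Fy).
  by apply: nearW => x; exact: subspace_valP.
apply/cvg_ex; exists (subspace_vec My).
apply/(@cvgrPdist_lt _ subspace_type) => e e0.
have /(@cvgrPdist_lt _ H)/(_ e e0) := Fy.
by apply: filterS => x; rewrite -subspace_norm raddfB.
Qed.

HB.instance Definition _ := Uniform_isComplete.Build subspace_type subspace_complete.

End SubspaceHilbert.

Section Operators.
Context (R : realType) (G : hilbertType R).

(* The default value is irrelevant for a bounded linear [A], which has exactly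
   one adjoint. *)
Definition adjoint (A : G -> G) : G -> G :=
  xget (fun=> 0) [set B | forall x y, dot (A x) y = dot x (B y)].

Definition orth_proj (M : closed_subspace G) (x : G) : G :=
  xget 0 [set y | carrier M y /\ forall z, carrier M z -> dot (x - y) z = 0].

Definition positive_op (A : G -> G) := forall x, 0 <= dot (A x) x.

Definition finite_rank (A : G -> G) := exists d, has_dim (range A) d.

End Operators.

(* Tuples of words (alpha_1, ..., alpha_k) in F_{n_1}^+ x ... x F_{n_k}^+ *)
Definition multiword k (n : 'I_k -> nat) := {dffun forall i : 'I_k, seq 'I_(n i)}.

Section OperatorTuples.
Context (R : realType) (k : nat) (n : 'I_k -> nat).

Definition op_tuple (G : hilbertType R) := forall i : 'I_k, 'I_(n i) -> G -> G.

Context (G : hilbertType R) (T : op_tuple G).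

Definition cp_map (i : 'I_k) (Y : G -> G) : G -> G :=
  fun x => \sum_(j < n i) T j (Y (adjoint (T j) x)).

(* (id - Phi_{T_1}) o ... o (id - Phi_{T_k}) applied to Y *)
Definition defect (Y : G -> G) : G -> G :=
  foldr (fun i Z x => Z x - cp_map i Z x) Y (enum 'I_k).

Definition word_op (i : 'I_k) (alpha : seq 'I_(n i)) : G -> G :=
  foldr (fun j A => T j \o A) idfun alpha.

Definition multiword_op (w : multiword n) : G -> G :=
  foldr (fun i A => word_op (w i) \o A) idfun (enum 'I_k).

Definition euler_space (q : 'I_k -> nat) : set G :=
  lspan [set x | exists (w : multiword n) h,
    [/\ forall i, (size (w i) <= q i)%N, range (defect idfun) h
      & x = multiword_op w h]].

Definition euler_ratio (q : 'I_k -> nat) : R :=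
  (lin_dim (euler_space q))%:R / (\prod_(i < k) \sum_(p < (q i).+1) n i ^ p)%N%:R.

Definition is_euler_characteristic (c : R) :=
  forall q : nat -> 'I_k -> nat,
    (forall m m', (m <= m')%N -> forall i, (q m i <= q m' i)%N) ->
    (forall p : 'I_k -> nat, exists m, forall i, (p i <= q m i)%N) ->
    euler_ratio (q m) @[m --> \oo] --> c.

(* The default value is only reached when the limit fails to exist or depends on
   the sequence q. *)
Definition euler_characteristic : R := xget 0 is_euler_characteristic.

Definition invariant_for (M : set G) :=
  forall i (j : 'I_(n i)) x, M x -> M (T j x).

Definition reducing_for (M : set G) :=
  invariant_for M /\ forall i (j : 'I_(n i)) x, M x -> M (adjoint (T j) x).

Definition contains_no_reducing (M : set G) :=
  forall L : closed_subspace G, reducing_for L -> L `<=` M -> carrier L = [set 0].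

Definition restrict_tuple (M : closed_subspace G) (hM : invariant_for M) :
    op_tuple (subspace_type M) :=
  fun i j x => subspace_vec (hM i j _ (subspace_valP x)).

Definition unitarily_equivalent (M N : closed_subspace G)
    (hM : invariant_for M) (hN : invariant_for N) :=
  exists U : {linear subspace_type M -> subspace_type N},
    [/\ bijective U, forall x y, dot (U x) (U y) = dot x y
      & forall i (j : 'I_(n i)) x,
          U (restrict_tuple hM j x) = restrict_tuple hN j (U x)].

End OperatorTuples.

Section Fock.
Context (R : realType) (k : nat) (n : 'I_k -> nat) (H : hilbertType R).
Implicit Types (f : l2 (multiword n) H) (w v : multiword n) (h : H).

(* The tensor product of the full Fock spaces F^2(C^{n_i}) and of H, realized as
   the H-valued square-summable families on tuples of words: the elementary
   tensor of e^1_{alpha_1}, ..., e^k_{alpha_k} and h is [ket (alpha_1, ..., alpha_k) h]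
   below (see [dot_ket_ket] and [ket_total]). *)
Definition fock : hilbertType R := l2 (multiword n) H.

Definition set_word w i (u : seq 'I_(n i)) : multiword n :=
  finfun (eqtype.dfwith w u).

Lemma set_wordE w i (u : seq 'I_(n i)) : set_word w u i = u.
Proof. by rewrite /set_word ffunE eqtype.dfwith_in. Qed.

Lemma set_word_set w i (u u' : seq 'I_(n i)) :
  set_word (set_word w u) u' = set_word w u'.
Proof.
apply/ffunP => i'; rewrite !ffunE; case: eqtype.dfwithP => [|i'' ne].
  by rewrite eqtype.dfwith_in.
by rewrite ffunE !eqtype.dfwith_out.
Qed.

Lemma set_word_id w i : set_word w (w i) = w.
Proof. by apply/ffunP => i'; rewrite ffunE; case: eqtype.dfwithP. Qed.

Definition prepend i (j : 'I_(n i)) w : multiword n := set_word w (j :: w i).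

Definition shift_fun i (j : 'I_(n i)) f w : H :=
  if w i is j' :: u then if j' == j then f (set_word w u) else 0 else 0.

Lemma shift_fun_prepend i (j : 'I_(n i)) f w :
  shift_fun j f (prepend j w) = f w.
Proof.
by rewrite /shift_fun /prepend set_wordE eqxx set_word_set set_word_id.
Qed.

Lemma shift_fun_neq0 i (j : 'I_(n i)) f w :
  shift_fun j f w != 0 -> w = prepend j (set_word w (behead (w i))).
Proof.
rewrite /shift_fun /prepend set_wordE set_word_set.
case wi : (w i) => [|j' u]; first by rewrite eqxx.
case: (eqVneq j' j) => [<- _|_]; last by rewrite eqxx.
by rewrite /= -wi set_word_id.
Qed.

Lemma shift_fun_l2 i (j : 'I_(n i)) f :
  shift_fun j f \in @square_summable_pred R (multiword n) H.
Proof.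
have [M fM] := l2P f; apply/asboolP; exists M => J.
pose nz := [fset w in J | shift_fun j f w != 0]%fset.
pose tl w := set_word w (behead (w i)).
have tlK w : w \in nz -> prepend j (tl w) = w.
  by rewrite !inE => /andP[_ /shift_fun_neq0 <-].
apply: le_trans (fM (tl @` nz)%fset).
rewrite big_imfset /=; last first.
  by move=> v w vn wn /(congr1 (prepend j)); rewrite !tlK.
rewrite (big_fsetID _ (fun w => shift_fun j f w != 0)) /=.
rewrite [X in _ + X]big_seq [X in _ + X]big1 ?addr0; last first.
  by move=> w; rewrite !inE negbK => /andP[_ /eqP ->]; rewrite normr0 expr0n.
rewrite big_seq [leRHS]big_seq; apply: ler_sum => w wn.
by rewrite -{1}(tlK w wn) shift_fun_prepend.
Qed.

(* S_{i,j} (x) I_H on the elementary tensors is given by [shift_ket] below. *)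
Definition fock_shift : op_tuple n fock := fun i j f => L2 (shift_fun_l2 j f).

Definition ket_fun w h : multiword n -> H := fun v => if v == w then h else 0.

Lemma ket_fun_l2 w h : ket_fun w h \in @square_summable_pred R (multiword n) H.
Proof.
apply/asboolP; have /complex_realP[M hM] : `|h| ^+ 2 \is @Num.real R[i].
  by rewrite ger0_real ?exprn_ge0.
exists M => J; rewrite -hM /ket_fun.
have [wJ|wJ] := boolP (w \in J).
  rewrite (big_fsetD1 w)//= eqxx big_seq big1 ?addr0// => v.
  by rewrite !inE => /andP[/negbTE-> _]; rewrite normr0 expr0n.
rewrite big_seq big1 ?exprn_ge0// => v vJ.
case: eqP => [vw|_]; last by rewrite normr0 expr0n.
by rewrite -vw vJ in wJ.
Qed.

Definition ket w h : fock := L2 (ket_fun_l2 w h).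

Lemma shift_ket i (j : 'I_(n i)) w h : fock_shift j (ket w h) = ket (prepend j w) h.
Proof.
apply/val_inj/funext => v /=; rewrite /ket_fun.
case: (eqVneq v (prepend j w)) => [->|vw].
  by rewrite shift_fun_prepend /= /ket_fun eqxx.
apply/eqP; apply: contraNT vw => nz; have vE := shift_fun_neq0 nz.
rewrite {1}vE; apply/eqP; congr prepend; move: nz.
rewrite {1}vE shift_fun_prepend /= /ket_fun.
by case: (eqVneq (set_word v _) w) => // _; rewrite eqxx.
Qed.

Lemma dot_ket (f : fock) w h : dot f (ket w h) = dot (f w) h.
Proof.
apply: l2_dotE; apply/(@cvgrPdist_le _ R[i]^o) => e e0.
exists [fset w]%fset => // J /= wJ; rewrite psumE distrC.
suff -> : \sum_(v <- J) dot (f v) (ket w h v) = dot (f w) h.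
  by rewrite subrr normr0 ltW.
have {}wJ : w \in J by apply: (fsubsetP wJ); rewrite inE.
rewrite (big_fsetD1 w)//= /ket_fun eqxx big_seq big1 ?addr0// => v.
by rewrite !inE => /andP[/negbTE-> _]; rewrite dot0r.
Qed.

Lemma dot_ket_ket v w g h : dot (ket v g) (ket w h) = if v == w then dot g h else 0.
Proof. by rewrite dot_ket /= /ket_fun eq_sym; case: eqP => // _; rewrite dot0l. Qed.

Lemma ket_total (f : fock) : (forall w h, dot f (ket w h) = 0) -> f = 0.
Proof.
move=> f0; apply/val_inj/funext => w /=; apply/eqP.
by rewrite -normr_eq0 -sqrf_eq0 -dot_norm -dot_ket f0.
Qed.

End Fock.

Arguments fock_shift {R k} n H i j f.

(* Main.v *)
From HB Require Import structures.
Require Import Defs.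
From mathcomp Require Import all_boot all_order all_algebra.
From mathcomp Require Import finmap complex ring lra.
From mathcomp Require Import all_classical all_reals topology normedtype.
From mathcomp.analysis.showcase Require summability.

Set Implicit Arguments.
Unset Strict Implicit.
Unset Printing Implicit Defensive.

Import Order.TTheory GRing.Theory Num.Theory.
Import numFieldNormedType.Exports.

Local Open Scope classical_set_scope.
Local Open Scope ring_scope.

(** An invariant subspace [M] with positive defect turns out to be a copy of
    a full tensor product of Fock spaces, with the range of the defect as
    coefficient space. The only unitary invariant is then the dimension of this
    range, and the Euler characteristic computes exactly that dimension.

    Let [T] be the restriction of the shifts to [M]. Its operators are
    isometries, those of one row have orthogonal ranges, and different rows
    commute. The defect operator of [M] is the defect of [T] extended by zero
    ([defect_restrict]), so positivity and finite rank pass to [T].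

    Positivity forces the rows to commute doubly, that is, the adjoints of one
    row commute with the operators of every other row. First, rows may be dropped
    from a positive defect ([positive_sub_cp_map]): if [Y - Phi_i(Y)] is positive
    then so are all [Y - Phi_i^m(Y)], and [Phi_i^m(Y)] tends to zero because the
    shifts are pure. This leaves the defect of just two rows, where positivity on
    vectors [T_(i,j) x], with [x] orthogonal to the row [l], shows that these are
    orthogonal to the row [l] too ([doubly_commuting_of_positive]).

    For doubly commuting rows the defect is the product of the projections onto
    the complements of the ranges of the rows; its range consists of the vectors
    killed by all adjoints. Translates of such vectors by different multiwords
    are orthogonal ([dot_multiword_op]), and all translates together are total in
    [M] ([wandering_total_on]): purity removes the rows one after the other, and
    purity of [T] itself is seen pointwise, since a sum of vectors shifted by
    words of length [m] in the row [l] vanishes at every multiword whose [l]-th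
    component is shorter than [m].

    So an orthonormal basis of the range of the defect, with [d] elements,
    generates an orthonormal total family of [M] indexed by multiwords and
    [d] labels. The Euler ratio is [d] for every bound [q]
    ([euler_characteristicE]). If two subspaces have the same [d], the unitary
    that matches their families intertwines the restrictions
    ([intertwined_of_dim]); conversely an intertwining unitary maps one range of
    the defect onto the other ([intertwined_defect_dim]). *)

(** * Linear maps, inner products and adjoints *)

Section LinearMaps.
Context (K : pzRingType) (V W : lmodType K) (f : V -> W) (fl : linear f).

Lemma linmap0 : f 0 = 0.
Proof. by apply: (@addrI _ (f 0)); rewrite -{1}[f 0]scale1r -fl scaler0 !addr0. Qed.

Lemma linmapD x y : f (x + y) = f x + f y.
Proof. by rewrite -{1}[x]scale1r fl scale1r. Qed.

Lemma linmapZ a x : f (a *: x) = a *: f x.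
Proof. by rewrite -[a *: x]addr0 fl linmap0 addr0. Qed.

Lemma linmapN x : f (- x) = - f x.
Proof. by rewrite -!scaleN1r linmapZ. Qed.

Lemma linmapB x y : f (x - y) = f x - f y.
Proof. by rewrite linmapD linmapN. Qed.

Lemma linmap_sum (I : Type) (r : seq I) (P : pred I) (F : I -> V) :
  f (\sum_(i <- r | P i) F i) = \sum_(i <- r | P i) f (F i).
Proof. exact: (big_morph f linmapD linmap0). Qed.

End LinearMaps.

Section InnerProducts.
Context (R : realType) (H : innerProductType R).
Implicit Types x y z : H.

Lemma dotNl x y : dot (- x) y = - dot x y.
Proof. by rewrite -scaleN1r dotZl mulN1r. Qed.

Lemma dotNr x y : dot x (- y) = - dot x y.
Proof. by rewrite -scaleN1r dotZr rmorphN1 mulN1r. Qed.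

Lemma dotBl x y z : dot (x - y) z = dot x z - dot y z.
Proof. by rewrite dotDl dotNl. Qed.

Lemma dotBr x y z : dot z (x - y) = dot z x - dot z y.
Proof. by rewrite dotDr dotNr. Qed.

Lemma dot_suml (I : Type) (r : seq I) (P : pred I) (F : I -> H) z :
  dot (\sum_(i <- r | P i) F i) z = \sum_(i <- r | P i) dot (F i) z.
Proof. by apply: (big_morph (dot ^~ z)) => [x y|]; rewrite (dotDl, dot0l). Qed.

Lemma dot_sumr (I : Type) (r : seq I) (P : pred I) (F : I -> H) z :
  dot z (\sum_(i <- r | P i) F i) = \sum_(i <- r | P i) dot z (F i).
Proof. by apply: (big_morph (dot z)) => [x y|]; rewrite (dotDr, dot0r). Qed.

Lemma dot_ge0 x : 0 <= dot x x.
Proof. by rewrite dot_norm exprn_ge0. Qed.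

Lemma dot_eq0 x : (dot x x == 0) = (x == 0).
Proof. by rewrite dot_norm sqrf_eq0 normr_eq0. Qed.

Lemma dot_inj x y : (forall z, dot x z = dot y z) -> x = y.
Proof. by move=> xy; apply/eqP; rewrite -subr_eq0 -dot_eq0 dotBl xy subrr. Qed.

Lemma dotr_inj x y : (forall z, dot z x = dot z y) -> x = y.
Proof. by move=> xy; apply: dot_inj => z; rewrite dotC xy -dotC. Qed.

Lemma Cauchy_Schwarz x y : `|dot x y| <= `|x| * `|y|.
Proof.
rewrite -ler_sqr ?nnegrE ?mulr_ge0// exprMn -!dot_norm.
have [->|y0] := eqVneq y 0; first by rewrite !dot0r mulr0 normr0 expr0n.
have dy : 0 < dot y y by rewrite lt_neqAle dot_ge0 eq_sym dot_eq0 y0.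
have := dot_ge0 (dot y y *: x + (- dot x y) *: y).
rewrite dotDl !dotDr !dotZl !dotZr -dotC rmorphN /= -!(dotC y x).
set a := dot x x; set b := dot y y; set c := dot x y; set d := dot y x.
have -> : `|c| ^+ 2 = c * d by rewrite normCK /c -dotC.
have -> : b * (b * a) + b * (- d * c) + (- c * (b * d) + - c * (- d * b)) =
   b * (a * b - c * d) by ring.
by rewrite pmulr_rge0// subr_ge0.
Qed.

Lemma Pythagoras x y : dot x y = 0 -> `|x + y| ^+ 2 = `|x| ^+ 2 + `|y| ^+ 2.
Proof. by move=> xy; rewrite normD_sqr (dotC y x) xy conjC0 !addr0. Qed.

Lemma parallelogram x y :
  `|x + y| ^+ 2 + `|x - y| ^+ 2 = `|x| ^+ 2 *+ 2 + `|y| ^+ 2 *+ 2.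
Proof. by rewrite -!dot_norm !dotBl !dotDl !dotBr !dotDr; ring. Qed.

End InnerProducts.

(** By polarization, norms determine inner products. *)
Lemma norm_dot_preserving (R : realType) (H K : innerProductType R) (f : H -> K) :
  linear f -> (forall x, `|f x| = `|x|) -> forall x y, dot (f x) (f y) = dot x y.
Proof.
move=> fl fn x y; apply: (@mulfI _ (4 : R[i])); first by rewrite pnatr_eq0.
by rewrite !dot_polar -!(linmapZ fl) -!(linmapB fl) -!(linmapD fl) !fn.
Qed.

Section Adjoints.
Context (R : realType) (G : hilbertType R).

(** [adjoint] picks a map by choice, so an explicit formula for it comes from
    exhibiting one adjoint and using that there is no other. *)
Lemma adjoint_unique (A B : G -> G) :
  (forall x y, dot (A x) y = dot x (B y)) -> adjoint A = B.
Proof.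
move=> AB; apply: xget_unique => // C AC.
by apply/funext => y; apply: dotr_inj => x; rewrite -AB -AC.
Qed.

Lemma adjoint_linear (A B : G -> G) :
  (forall x y, dot (A x) y = dot x (B y)) -> linear B.
Proof.
move=> AB a x y; apply: dotr_inj => z.
by rewrite -AB !dotDr !dotZr !AB.
Qed.

End Adjoints.

(** * Orthogonal projections *)

Section ProjectionTheorem.
Context (R : realType) (G : hilbertType R) (M : closed_subspace G).

(** Norms take values in [R[i]], where infima are not available; the squared
    norm as a real number is what gets minimized. *)
Definition sqnorm (x : G) : R := complex.Re (dot x x).

Lemma sqnormE x : dot x x = (sqnorm x)%:C%C.
Proof. by rewrite /sqnorm RRe_real// ger0_real// dot_ge0. Qed.

Lemma sqnorm_ge0 x : 0 <= sqnorm x.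
Proof. by rewrite -lecR -sqnormE dot_ge0. Qed.

Lemma closed_subspaceD x y : carrier M x -> carrier M y -> carrier M (x + y).
Proof. by move=> Mx My; rewrite -[x](scale1r (x : G)); apply: (carrier_subspace M).2. Qed.

Lemma closed_subspaceZ a x : carrier M x -> carrier M (a *: x).
Proof.
by move=> Mx; rewrite -[_ *: _]addr0; apply: (carrier_subspace M).2 => //;
  apply: (carrier_subspace M).1.
Qed.

Lemma closed_subspaceB x y : carrier M x -> carrier M y -> carrier M (x - y).
Proof.
by move=> Mx My; rewrite -scaleN1r; apply: closed_subspaceD => //; apply: closed_subspaceZ.
Qed.

(** By the parallelogram identity, two points of [M] whose squared distances to
    [x] are within [e] of the infimum are at squared distance at most [4 * e],
    so the almost minimizing points form a Cauchy filter. *)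
Lemma nearest_point x : exists y, carrier M y /\
  forall z, carrier M z -> sqnorm (x - y) <= sqnorm (x - z).
Proof.
pose S := [set sqnorm (x - z) | z in carrier M].
have M0 := (carrier_subspace M).1.
have Sinf : has_inf S.
  by split; [exists (sqnorm (x - 0)); exists 0|exists 0 => _ [z _ <-]; exact: sqnorm_ge0].
have lbS z : carrier M z -> inf S <= sqnorm (x - z).
  by move=> Mz; apply: ge_inf; [exact: Sinf.2|exists z].
pose A (e : R) := [set z | carrier M z /\ sqnorm (x - z) < inf S + e].
pose F := filter_from [set e | 0 < e] A.
have FF : ProperFilter F.
  apply: filter_from_proper.
    apply: filter_from_filter; first by exists 1; exact: ltr01.
    move=> a b a0 b0; exists (Num.min a b); first by rewrite /= lt_min a0.
    move=> z [Mz]; rewrite -ltrBlDl lt_min => /andP[za zb].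
    by split; split => //; rewrite -ltrBlDl.
  move=> e e0; have [_ [z Mz <-] ze] := inf_adherent e0 Sinf.
  by exists z.
have FA e : 0 < e -> F (A e) by move=> e0; exists e.
have close e y z : A e y -> A e z -> sqnorm (y - z) <= 4 * e.
  move=> [My ye] [Mz ze].
  have Mw : carrier M (2^-1 *: (y + z)) by apply/closed_subspaceZ/closed_subspaceD.
  have := lbS _ Mw.
  have := @parallelogram R G (x - y) (x - z).
  have -> : x - y + (x - z) = (2 : R[i]) *: (x - 2^-1 *: (y + z)).
    rewrite scalerBr scalerA divff ?pnatr_eq0// scale1r scaler_nat opprD.
    by rewrite addrACA mulr2n.
  have -> : x - y - (x - z) = z - y.
    by rewrite opprB addrC addrA subrK.
  rewrite normrZ exprMn -!dot_norm !sqnormE normr_nat.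
  have -> : (2 : R[i]) ^+ 2 = ((2 ^+ 2 : R)%:C)%C by rewrite rmorphXn /= rmorph_nat.
  rewrite -!rmorphMn -rmorphM -!rmorphD => /complexI.
  have -> : sqnorm (y - z) = sqnorm (z - y).
    by rewrite /sqnorm -opprB dotNl dotNr opprK.
  move: (sqnorm _) (sqnorm _) (sqnorm _) (sqnorm _) ye ze => a b c d; lra.
have Fc : cauchy F.
  apply/cauchy_ballP => e e0.
  have eE : e = (complex.Re e)%:C%C by rewrite RRe_real// ger0_real// ltW.
  have e0' : 0 < complex.Re e by rewrite -ltcR -eE.
  have d0 : 0 < (complex.Re e) ^+ 2 / 8 by rewrite divr_gt0// exprn_gt0.
  exists (A ((complex.Re e) ^+ 2 / 8), A ((complex.Re e) ^+ 2 / 8)); first by split; exact: FA.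
  move=> [y z] [/= Ay Az]; rewrite -ball_normE /=.
  rewrite -ltr_sqr ?nnegrE ?(ltW e0)// -dot_norm sqnormE eE -rmorphXn /= ltcR.
  apply: le_lt_trans (close _ _ _ Ay Az) _.
  move: d0; lra.
have Fv : cvg F by apply: cauchy_cvg.
have [y Fy] := (cvg_ex _).1 Fv.
have My : carrier M y.
  refine (@closed_cvg _ G F FF id (carrier M) (@carrier_closed _ _ M) _ y Fy).
  by apply: filterS (FA 1 ltr01) => z [].
exists y; split=> // z Mz; apply: le_trans (lbS _ Mz).
apply/ler_addgt0Pr => e e0.
have cv : (fun h : G => `|x - h| ^+ 2 : R[i]^o) @ F --> (`|x - y| ^+ 2 : R[i]^o).
  apply: (@cvg_sqr R[i] _ F FF); apply: cvg_norm.
  by apply: cvgB; [exact: cvg_cst|exact: Fy].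
have := @cvg_complexRe R _ F _ _ _ cv; move=> /(_ FF) cvR.
rewrite /sqnorm dot_norm.
apply: (@cvgr_to_le _ F FF R _ _ _ cvR).
by apply: filterS (FA _ e0) => w [_ /ltW]; rewrite /sqnorm dot_norm.
Qed.

(** If the residual [x - y] had a component [a *: z] along some [z] in [M], then
    [y + a *: z] would be nearer to [x]. *)
Lemma orth_proj_exists x :
  exists y, carrier M y /\ forall z, carrier M z -> dot (x - y) z = 0.
Proof.
have [y [My ymin]] := nearest_point x; exists y; split=> // z Mz.
have [->|z0] := eqVneq z 0; first by rewrite dot0r.
pose a := dot (x - y) z / dot z z.
have uz : dot (x - y - a *: z) (a *: z) = 0.
  by rewrite dotBl dotZl !dotZr /a mulrCA divfK ?dot_eq0// subrr.
have := ymin (y + a *: z) (closed_subspaceD My (closed_subspaceZ _ Mz)).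
rewrite -lecR -!sqnormE opprD addrA !dot_norm.
rewrite -{1}(subrK (a *: z) (x - y)) Pythagoras// gerDl => az.
have /eqP : a *: z = 0.
  apply/eqP; rewrite -normr_eq0 -sqrf_eq0; apply/eqP/le_anti.
  by rewrite az exprn_ge0.
by rewrite scaler_eq0 (negbTE z0) orbF /a mulf_eq0 invr_eq0 dot_eq0 (negbTE z0) orbF => /eqP.
Qed.

Lemma orth_projP x : carrier M (orth_proj M x) /\
  forall z, carrier M z -> dot (x - orth_proj M x) z = 0.
Proof.
exact: (@xgetPex _ 0 [set y | carrier M y /\ forall z, carrier M z -> dot (x - y) z = 0]
  (orth_proj_exists x)).
Qed.

Lemma orth_proj_in x : carrier M (orth_proj M x).
Proof. by have [] := orth_projP x. Qed.

Lemma dot_orth_proj x z : carrier M z -> dot (orth_proj M x) z = dot x z.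
Proof.
by move=> Mz; have [_ /(_ z Mz)] := orth_projP x; rewrite dotBl => /subr0_eq.
Qed.

Lemma orth_proj_unique x y : carrier M y ->
  (forall z, carrier M z -> dot y z = dot x z) -> orth_proj M x = y.
Proof.
move=> My yP; apply/eqP; rewrite -subr_eq0 -dot_eq0.
have Mu := closed_subspaceB (orth_proj_in x) My.
by rewrite {1}dotBl dot_orth_proj// yP// subrr.
Qed.

Lemma orth_proj_id x : carrier M x -> orth_proj M x = x.
Proof. by move=> Mx; apply: orth_proj_unique. Qed.

Lemma orth_proj_linear : linear (orth_proj M).
Proof.
move=> a x y; apply: orth_proj_unique.
  by apply: closed_subspaceD (orth_proj_in _); apply/closed_subspaceZ/orth_proj_in.
by move=> z Mz; rewrite !dotDl !dotZl !dot_orth_proj.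
Qed.

Lemma orth_proj_norm x : `|orth_proj M x| <= `|x|.
Proof.
rewrite -ler_sqr ?nnegrE// -[x in leRHS](subrK (orth_proj M x)).
rewrite Pythagoras ?lerDr ?exprn_ge0//.
by rewrite (orth_projP x).2//; exact: orth_proj_in.
Qed.

End ProjectionTheorem.

(** * Dimension and orthonormal bases *)

Section Dimension.
Context (R : realType) (G : hilbertType R).
Implicit Types (V : set G).

Definition combinations (I : finType) (b : I -> G) : set G :=
  range (fun c : I -> R[i] => \sum_i c i *: b i).

Definition independent (I : finType) (b : I -> G) :=
  forall c : I -> R[i], \sum_i c i *: b i = 0 -> forall i, c i = 0.

Lemma combinations_subspace (I : finType) (b : I -> G) :
  is_subspace (combinations b).
Proof.
split; first by exists (fun=> 0) => //; rewrite big1// => i _; rewrite scale0r.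
move=> a _ _ [c _ <-] [d _ <-]; exists (fun i => a * c i + d i) => //.
rewrite scaler_sumr -big_split; apply: eq_bigr => i _.
by rewrite scalerDl scalerA.
Qed.

Lemma mem_combinations (I : finType) (b : I -> G) i : combinations b (b i).
Proof.
exists (fun l => (l == i)%:R) => //; rewrite (bigD1 i)//= eqxx scale1r big1 ?addr0//.
by move=> l /negbTE ->; rewrite scale0r.
Qed.

Lemma subspace_sum V (I : Type) (r : seq I) (P : pred I) (F : I -> G) :
  is_subspace V -> (forall i, P i -> V (F i)) -> V (\sum_(i <- r | P i) F i).
Proof.
move=> [V0 Vlin] VF; elim/big_ind : _ => // x y Vx Vy.
by rewrite -[x](scale1r (x : G)); exact: Vlin.
Qed.

Lemma combinations_sub (I : finType) (b : I -> G) V :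
  is_subspace V -> (forall i, V (b i)) -> combinations b `<=` V.
Proof.
move=> Vs Vb _ [c _ <-]; apply: subspace_sum => // i _.
by rewrite -[_ *: _]addr0; apply: Vs.2 => //; exact: Vs.1.
Qed.

Lemma has_dim_combinations (I : finType) (b : I -> G) :
  independent b -> has_dim (combinations b) #|I|.
Proof.
have sumE (c : 'I_#|I| -> R[i]) :
    \sum_i c i *: b (enum_val i) = \sum_x c (enum_rank x) *: b x.
  by rewrite [RHS](reindex _ (onW_bij _ (@enum_val_bij I)))/=;
    apply: eq_bigr => i _; rewrite enum_valK.
move=> bI; exists (b \o enum_val); split.
  by move=> c; rewrite sumE => /bI c0 i; rewrite -(enum_valK i).
apply/seteqP; split => [_ [c _ <-]|_ [c _ <-]].
  exists (c \o enum_val) => //; rewrite /= (sumE (c \o enum_val)).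
  by apply: eq_bigr => x _; rewrite /= enum_rankK.
by exists (c \o enum_rank) => //=; rewrite sumE.
Qed.

Lemma has_dim_le V d d' : has_dim V d -> has_dim V d' -> (d <= d')%N.
Proof.
move=> [b [bI Vb]] [b' [b'I Vb']].
have bV i : exists c : 'I_d' -> R[i], \sum_j c j *: b' j = b i.
  have : V (b i) by rewrite Vb; exact: mem_combinations.
  by rewrite Vb' => -[c _ <-]; exists c.
have bV' j : exists c : 'I_d -> R[i], \sum_i c i *: b i = b' j.
  have : V (b' j) by rewrite Vb'; exact: mem_combinations.
  by rewrite Vb => -[c _ <-]; exists c.
have [A AE] := choice bV; have [B BE] := choice bV'.
apply: (@mulmx1_min R[i] _ _ (\matrix_(i, j) A i j) (\matrix_(j, i) B j i)).
apply/matrixP => i l; rewrite !mxE.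
under eq_bigr do rewrite !mxE.
pose c l := \sum_j A i j * B j l - (i == l)%:R.
suff /bI/(_ l)/subr0_eq : \sum_l c l *: b l = 0 by [].
under eq_bigr do rewrite scalerBl scaler_suml.
have deltaE : \sum_l (i == l)%:R *: b l = b i.
  rewrite (bigD1 i)//= eqxx scale1r big1 ?addr0// => m.
  by move=> /negbTE; rewrite eq_sym => ->; rewrite scale0r.
rewrite sumrB exchange_big /= deltaE.
rewrite -[b i]AE; apply/eqP; rewrite subr_eq0; apply/eqP; apply: eq_bigr => j _.
by rewrite -BE scaler_sumr; apply: eq_bigr => m _; rewrite scalerA.
Qed.

Lemma has_dim_unique V d d' : has_dim V d -> has_dim V d' -> d = d'.
Proof. by move=> Vd Vd'; apply/anti_leq/andP; split; apply: has_dim_le; eauto. Qed.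

Lemma lin_dimE V d : has_dim V d -> lin_dim V = d.
Proof.
by move=> Vd; apply: (@xget_unique _ 0%N) => // d' Vd'; apply: has_dim_unique Vd' Vd.
Qed.

Definition orthonormal_family (I : eqType) (e : I -> G) :=
  forall i l, dot (e i) (e l) = (i == l)%:R.

Lemma orthonormal_independent (I : finType) (e : I -> G) :
  orthonormal_family e -> independent e.
Proof.
move=> eo c c0 i; have := congr1 (dot ^~ (e i)) c0.
rewrite dot0l dot_suml (bigD1 i)//= dotZl eo eqxx mulr1 big1 ?addr0//.
by move=> l /negbTE li; rewrite dotZl eo li mulr0.
Qed.

(** Vectors that depend on earlier ones are discarded, so the size of the
    orthonormal family is left open; [orthonormal_basis] recovers it from the
    uniqueness of dimension. *)
Lemma Gram_Schmidt d (b : 'I_d -> G) : exists (I : finType) (e : I -> G),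
  orthonormal_family e /\ combinations e = combinations b.
Proof.
elim: d b => [|d IHd] b.
  exists 'I_0, b; split=> // -[] //.
have [I [e [eo eb]]] := IHd (b \o lift ord0).
have span_e (J : finType) (f : J -> G) : (forall i, combinations f (b (lift ord0 i))) ->
    combinations e `<=` combinations f.
  by move=> fb; rewrite eb; apply: combinations_sub => //; exact: combinations_subspace.
pose y := \sum_i dot (b ord0) (e i) *: e i.
have ye i : dot y (e i) = dot (b ord0) (e i).
  rewrite dot_suml (bigD1 i)//= dotZl eo eqxx mulr1 big1 ?addr0//.
  by move=> l /negbTE li; rewrite dotZl eo li mulr0.
have sub_e V : is_subspace V -> combinations e `<=` V -> V y.
  move=> Vs; apply; apply: subspace_sum; first exact: combinations_subspace.
  move=> i _; rewrite -[_ *: _]addr0; apply: (combinations_subspace e).2.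
    exact: mem_combinations.
  exact: (combinations_subspace e).1.
have eb' : combinations e `<=` combinations b.
  by apply: span_e => i; exact: mem_combinations.
have [yb|yb] := eqVneq y (b ord0).
  exists I, e; split=> //; apply/seteqP; split=> //.
  apply: combinations_sub; first exact: combinations_subspace.
  move=> i; case: (unliftP ord0 i) => [l ->|->].
    by rewrite eb; exact: (mem_combinations (b \o lift ord0)).
  by rewrite -yb; apply: sub_e => //; exact: combinations_subspace.
pose v := b ord0 - y.
have v0 : v != 0 by rewrite subr_eq0 eq_sym.
have nv0 : `|v| != 0 by rewrite normr_eq0.
pose u := `|v|^-1 *: v.
have ue i : dot u (e i) = 0 by rewrite dotZl dotBl ye subrr mulr0.
have uu : dot u u = 1.
  rewrite dotZl dotZr dot_norm conj_Creal ?rpredV ?normr_real//.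
  by rewrite expr2 mulKf// mulVf.
pose e' (o : option I) := if o is Some i then e i else u.
exists (option I), e'; split.
  move=> [i|] [l|] //=; rewrite ?ue ?uu ?eo//.
  by rewrite dotC ue conjC0.
have ee' : combinations e `<=` combinations e'.
  apply: combinations_sub => [|i]; first exact: combinations_subspace.
  exact: (mem_combinations e' (Some i)).
have [e'0 e'lin] := combinations_subspace e'.
have [b0 blin] := combinations_subspace b.
apply/seteqP; split.
  apply: combinations_sub; first exact: combinations_subspace.
  move=> [i|]; first exact/eb'/mem_combinations.
  rewrite /e' /u -[_ *: _]addr0; apply: (blin) => //.
  rewrite /v addrC -scaleN1r; apply: blin; last exact: mem_combinations.
  by apply: sub_e => //; exact: combinations_subspace.
apply: combinations_sub; first exact: combinations_subspace.
move=> i; case: (unliftP ord0 i) => [l ->|->].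
  by apply: ee'; rewrite eb; exact: (mem_combinations (b \o lift ord0)).
have -> : b ord0 = `|v| *: u + y by rewrite scalerA mulfV// scale1r subrK.
apply: e'lin; first exact: (mem_combinations e' None).
by apply: sub_e => //; exact: combinations_subspace.
Qed.

Lemma orthonormal_basis V d : has_dim V d ->
  exists e : 'I_d -> G, orthonormal_family e /\ V = combinations e.
Proof.
move=> Vd; have [b [_ Vb]] := Vd; have [I [e [eo eb]]] := Gram_Schmidt b.
have {}eb : V = combinations e by rewrite eb Vb.
have dI : d = #|I|.
  apply: has_dim_unique Vd _.
  by rewrite eb; apply/has_dim_combinations/orthonormal_independent.
subst d; exists (e \o enum_val); split; first by move=> i l; rewrite eo (inj_eq enum_val_inj).
rewrite eb; apply/seteqP; split; apply: combinations_sub;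
  try exact: combinations_subspace; move=> i.
  by rewrite -(enum_rankK i); exact: (mem_combinations (e \o enum_val)).
exact: mem_combinations.
Qed.

End Dimension.

Lemma has_dim_image (R : realType) (G K : hilbertType R) (f : G -> K) V d :
  linear f -> injective f -> has_dim (f @` V) d <-> has_dim V d.
Proof.
move=> fl fi; have sumE (b : 'I_d -> G) (c : 'I_d -> R[i]) :
    f (\sum_i c i *: b i) = \sum_i c i *: f (b i).
  by rewrite (linmap_sum fl); apply: eq_bigr => i _; rewrite linmapZ.
split=> [[b [bI Vb]]|[b [bI Vb]]].
  have bV i : exists x, V x /\ f x = b i.
    have : (f @` V) (b i) by rewrite Vb; exact: mem_combinations.
    by case=> x Vx fx; exists x.
  have [a aP] := choice bV; exists a.
  have sumE' c : f (\sum_i c i *: a i) = \sum_i c i *: b i.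
    by rewrite sumE; apply: eq_bigr => i _; rewrite (aP i).2.
  split=> [c c0|]; first by apply: bI; rewrite -sumE' c0 linmap0.
  apply/seteqP; split=> [x Vx|_ [c _ <-]].
    have : (f @` V) (f x) by exists x.
    by rewrite Vb => -[c _ cx]; exists c => //; apply: fi; rewrite -cx sumE'.
  have : (f @` V) (\sum_i c i *: b i) by rewrite Vb; exists c.
  by case=> x Vx; rewrite -sumE' => /fi <-.
exists (f \o b); split=> [c|].
  by rewrite -(sumE b) -(linmap0 fl) => /fi; exact: bI.
rewrite Vb; apply/seteqP; split=> [_ [_ [c _ <-] <-]|_ [c _ <-]].
  by exists c => //; rewrite sumE.
by exists (\sum_i c i *: b i); [exists c|rewrite sumE].
Qed.

(** * Unitaries between spaces with orthonormal bases *)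

(** Sums over an arbitrary index type are limits along the filter of finite
    subsets ordered by inclusion. *)
Local Existing Instance summability.totally_filter.

Lemma normc_ge_Im (R : realType) (z : R[i]) : `|complex.Im z|%:C%C <= `|z|.
Proof.
rewrite normc_def lecR -[leLHS]ger0_norm// -sqrtr_sqr.
by rewrite ler_wsqrtr// real_normK ?num_real// lerDr sqr_ge0.
Qed.

Lemma big_fset_subD (I : choiceType) (V : nmodType) (F : I -> V) (J0 J : {fset I}) :
  (J0 `<=` J)%fset ->
  \sum_(i <- J) F i = \sum_(i <- J0) F i + \sum_(i <- (J `\` J0)%fset) F i.
Proof.
move=> /fsubsetP JJ; rewrite (big_fsetID _ (mem J0)) /=; congr (_ + _).
  by apply: eq_fbigl => i; rewrite !inE /=; apply/andP/idP => [[]|iJ]//; split=> //; exact: JJ.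
by apply: eq_fbigl => i; rewrite !inE /= andbC.
Qed.

Lemma ge0_of_approx (R : realType) (z : R[i]) :
  (forall e : R[i], 0 < e -> exists z', 0 <= z' /\ `|z - z'| <= e) -> 0 <= z.
Proof.
move=> az; rewrite lecE /=.
have key (e : R) : 0 < e -> `|complex.Im z| <= e /\ - e <= complex.Re z.
  move=> e0; have [|z' [z'0 zz']] := az e%:C%C; first by rewrite ltcR.
  move: z'0; rewrite lecE /= => /andP[/eqP Iz' Rz'].
  have := le_trans (normc_ge_Im _) zz'; have := le_trans (normc_ge_Re _) zz'.
  rewrite !lecR !raddfB /= Iz' subr0 => Re_le ?; split=> //.
  move: Re_le; rewrite ler_norml => /andP[Re_le _].
  by apply: le_trans Re_le _; rewrite gerBl.
apply/andP; split.
  rewrite -normr_le0; apply/ler_addgt0Pr => e e0.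
  by rewrite add0r (key _ e0).1.
by apply/ler_addgt0Pr => e e0; rewrite -lerBlDr sub0r (key _ e0).2.
Qed.

Lemma eq_of_approx (K : numFieldType) (V : normedModType K) (x y : V) :
  (forall e : K, 0 < e -> `|x - y| <= e) -> x = y.
Proof.
move=> xy; apply/eqP; rewrite -subr_eq0 -normr_le0; apply/ler_addgt0Pr => e e0.
by rewrite add0r xy.
Qed.

Section RieszFischer.
Context (R : realType) (I : choiceType).

Section Bessel.
Context (G : hilbertType R) (e : I -> G) (eo : orthonormal_family e).
Implicit Types (J : {fset I}) (c : I -> R[i]).

Lemma dot_orthonormal_sum c J i :
  dot (\sum_(l <- J) c l *: e l) (e i) = if i \in J then c i else 0.
Proof.
rewrite dot_suml; case: ifPn => iJ.
  rewrite (big_fsetD1 i)//= dotZl eo eqxx mulr1 big_seq big1 ?addr0// => l.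
  by rewrite !inE => /andP[/negbTE li _]; rewrite dotZl eo li mulr0.
rewrite big_seq big1// => l lJ; rewrite dotZl eo.
by case: eqP => [li|_]; [rewrite -li lJ in iJ|rewrite mulr0].
Qed.

Lemma norm_orthonormal_sum c J :
  `|\sum_(l <- J) c l *: e l| ^+ 2 = \sum_(l <- J) `|c l| ^+ 2.
Proof.
rewrite -dot_norm dot_sumr big_seq [RHS]big_seq; apply: eq_bigr => l lJ.
by rewrite dotZr dot_orthonormal_sum lJ normCK mulrC.
Qed.

Lemma Bessel x J : \sum_(l <- J) `|dot x (e l)| ^+ 2 <= `|x| ^+ 2.
Proof.
pose y := \sum_(l <- J) dot x (e l) *: e l.
have ye : dot (x - y) y = 0.
  rewrite dot_sumr big_seq big1// => l lJ.
  by rewrite dotZr dotBl dot_orthonormal_sum lJ subrr mulr0.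
by rewrite -norm_orthonormal_sum -/y -[x](subrK y) (Pythagoras ye) lerDr exprn_ge0.
Qed.

End Bessel.

(** The coefficients of [x] are square summable by Bessel's inequality, so the
    partial sums of [dot x (e i) *: f i] form a Cauchy net; [y] is its limit. *)
Lemma Riesz_Fischer (G K : hilbertType R) (e : I -> G) (f : I -> K) x :
  orthonormal_family e -> orthonormal_family f ->
  exists y, (forall i, dot y (f i) = dot x (e i)) /\ `|y| <= `|x|.
Proof.
move=> eo fo; pose c i := dot x (e i).
pose s (J : {fset I}) := \sum_(i <- J) c i *: f i.
have [|J|l [cl lub _]] := @cvg_psum_ge0 R I (fun i => `|c i| ^+ 2) (sqnorm x).
- by move=> i; rewrite exprn_ge0.
- by rewrite psumE -sqnormE dot_norm; exact: Bessel.
have tail (a : R[i]) : 0 < a -> exists J0, forall J, (J0 `<=` J)%fset -> `|s J - s J0| < a.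
  move=> a0; have a20 : 0 < a ^+ 2 by rewrite exprn_gt0.
  have /(@cvgrPdist_lt _ R[i]^o)/(_ _ a20) := cl.
  move=> [J0 _ J0l]; exists J0 => J JJ.
  rewrite -ltr_sqr ?nnegrE ?(ltW a0)//.
  rewrite /s (big_fset_subD _ JJ) addrC addKr norm_orthonormal_sum//.
  apply: le_lt_trans (J0l J0 (fsubset_refl _)).
  have := lub J; rewrite !psumE (big_fset_subD _ JJ) addrC -lerBrDr => lubJ.
  apply: le_trans lubJ _; rewrite ger0_norm ?psumE//.
  by rewrite subr_ge0 -(psumE (fun i => `|c i| ^+ 2)) lub.
have Fc : cauchy (s @ summability.totally).
  apply/cauchy_ballP => a a0; have a20 : 0 < a / 2 by rewrite divr_gt0.
  have [J0 J0a] := tail _ a20; pose A := s @` [set J | (J0 `<=` J)%fset].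
  have FA : (s @ summability.totally) A by exists J0 => // J /= JJ; exists J.
  exists (A, A); first by split.
  move=> [_ _] [/= [J JJ <-] [J' JJ' <-]]; rewrite -ball_normE /=.
  rewrite -(subrK (s J0) (s J)) -addrA (splitr a).
  apply: le_lt_trans (ler_normD _ _) _; rewrite ltrD ?J0a//.
  by rewrite distrC J0a.
have Fv : cvg (s @ summability.totally) by apply: cauchy_cvg.
have [y /cvgrPdist_lt sy] := (cvg_ex _).1 Fv.
have near i (a : R[i]) : 0 < a -> exists J, i \in J /\ `|y - s J| < a.
  move=> /sy[J0 _ J0y]; exists (i |` J0)%fset; split; first by rewrite !inE eqxx.
  by apply: J0y; exact: fsubsetU1.
exists y; split=> [i|].
  apply: (@eq_of_approx _ R[i]^o) => a a0; have [J [iJ yJ]] := near i a a0.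
  have -> : dot x (e i) = dot (s J) (f i) by rewrite dot_orthonormal_sum// iJ.
  rewrite -dotBl; apply: le_trans (Cauchy_Schwarz _ _) _.
  have -> : `|f i| = 1.
    by apply/eqP; rewrite -(@eqrXn2 _ 2)// expr1n -dot_norm fo eqxx.
  by rewrite mulr1 ltW.
apply/ler_addgt0Pr => a a0; have [J0 _ /(_ J0 (fsubset_refl _)) yJ] := sy a a0.
rewrite -(subrK (s J0) y) addrC; apply: le_trans (ler_normD _ _) _.
apply: lerD; last exact: ltW.
by rewrite -ler_sqr ?nnegrE// norm_orthonormal_sum//; exact: Bessel.
Qed.

Definition total_family (G : innerProductType R) (e : I -> G) :=
  forall x, (forall i, dot x (e i) = 0) -> x = 0.

Lemma total_inj (G : innerProductType R) (e : I -> G) x y :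
  total_family e -> (forall i, dot x (e i) = dot y (e i)) -> x = y.
Proof.
by move=> et xy; apply/eqP; rewrite -subr_eq0; apply/eqP/et => i; rewrite dotBl xy subrr.
Qed.

(** Transporting coefficients from [e] to [f] and back gives mutually inverse
    contractions, hence isometries. *)
Lemma unitary_of_bases (G K : hilbertType R) (e : I -> G) (f : I -> K) :
  orthonormal_family e -> orthonormal_family f -> total_family e -> total_family f ->
  exists U : {linear G -> K}, [/\ bijective U, forall x y, dot (U x) (U y) = dot x y
    & forall x i, dot (U x) (f i) = dot x (e i)].
Proof.
move=> eo fo et ft.
have [U UP] := choice (fun x => Riesz_Fischer x eo fo).
have [V VP] := choice (fun x => Riesz_Fischer x fo eo).
have UV : cancel V U by move=> x; apply: (total_inj ft) => i; rewrite (UP _).1 (VP _).1.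
have VU : cancel U V by move=> x; apply: (total_inj et) => i; rewrite (VP _).1 (UP _).1.
have Ulin : linear U.
  by move=> a x y; apply: (total_inj ft) => i; rewrite !(dotDl, dotZl, (UP _).1).
have Unorm x : `|U x| = `|x|.
  by apply/le_anti; rewrite (UP _).2 -{1}(VU x) (VP _).2.
pose U' : {linear G -> K} := HB.pack U (GRing.isLinear.Build _ _ _ _ U Ulin).
exists U'; split; first by exists V.
  exact: norm_dot_preserving.
by move=> x i; rewrite (UP x).1.
Qed.

End RieszFischer.

(** * Tuples of row isometries and their defects *)

Section RowIsometries.
Context (R : realType) (k : nat) (n : 'I_k -> nat) (G : hilbertType R).
Context (T : op_tuple n G).
Implicit Types (x y : G) (i l : 'I_k).

(** For each [i] the operators [T i j] are isometries with orthogonal ranges, and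
    different rows commute. The field [ri_adjoint] guarantees that [adjoint] is not its
    default value. *)
Record row_isometries : Prop := RowIsometries {
  ri_linear : forall i (j : 'I_(n i)), linear (T j);
  ri_adjoint : forall i (j : 'I_(n i)) x y,
    dot (T j x) y = dot x (adjoint (T j) y);
  ri_orth : forall i (j m : 'I_(n i)) x,
    adjoint (T j) (T m x) = if j == m then x else 0;
  ri_comm : forall i l (j : 'I_(n i)) (m : 'I_(n l)) x,
    i != l -> T j (T m x) = T m (T j x)
}.

(** Together with purity, this is what distinguishes shifts on a tensor product of
    Fock spaces from arbitrary commuting row isometries. *)
Definition doubly_commuting := forall i l (j : 'I_(n i)) (m : 'I_(n l)) x,
  i != l -> adjoint (T m) (T j x) = T j (adjoint (T m) x).

(** [defect] is the case [s = enum 'I_k]; inductions on the defect run over the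
    list of rows that have been treated. *)
Definition defect_on (s : seq 'I_k) (Y : G -> G) : G -> G :=
  foldr (fun i Z x => Z x - cp_map T i Z x) Y s.

(** The projection onto the orthogonal complement of the span of the ranges of
    [T i j], for [j] ranging over the row [i]. *)
Definition wandering_proj i : G -> G := fun x => x - cp_map T i idfun x.

(** A form of [bigcap_m span_(|alpha| = m) (ran T_(l, alpha)) = 0]: on a set [K] as
    below every [x] is the sum of the [T l j (adjoint (T l j) x)], whose summands
    again come from [K], so [K] lies in this intersection. Stating purity
    coinductively avoids projections and limits. *)
Definition completely_pure := forall l (K : set G),
  (forall (j : 'I_(n l)) x, K x -> K (adjoint (T j) x)) ->
  (forall x, K x -> wandering_proj l x = 0) -> forall x, K x -> x = 0.

Hypothesis Tri : row_isometries.

Lemma adj_linear i (j : 'I_(n i)) : linear (adjoint (T j)).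
Proof. exact: adjoint_linear (ri_adjoint Tri j). Qed.

Lemma adj_comm i l (j : 'I_(n i)) (m : 'I_(n l)) x : i != l ->
  adjoint (T j) (adjoint (T m) x) = adjoint (T m) (adjoint (T j) x).
Proof.
by move=> il; apply: dotr_inj => y; rewrite -!(ri_adjoint Tri) (ri_comm Tri _ _ _ il).
Qed.

Lemma dot_adj i (j : 'I_(n i)) x y : dot x (T j y) = dot (adjoint (T j) x) y.
Proof. by rewrite dotC (ri_adjoint Tri) -dotC. Qed.

Lemma dot_row_isometry i (j : 'I_(n i)) x y : dot (T j x) (T j y) = dot x y.
Proof. by rewrite (ri_adjoint Tri) (ri_orth Tri) eqxx. Qed.

Lemma norm_row_isometry i (j : 'I_(n i)) x : `|T j x| = `|x|.
Proof. by apply/eqP; rewrite -(@eqrXn2 _ 2)// -!dot_norm dot_row_isometry. Qed.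

Lemma adj_norm i (j : 'I_(n i)) x : `|adjoint (T j) x| <= `|x|.
Proof.
have [->|nz] := eqVneq (adjoint (T j) x) 0; first by rewrite normr0.
have nz' : 0 < `|adjoint (T j) x| by rewrite normr_gt0.
rewrite -(ler_pM2l nz') -expr2 -dot_norm -[leLHS]ger0_norm ?dot_ge0//.
by rewrite -dot_adj mulrC; apply: le_trans (Cauchy_Schwarz _ _) _; rewrite norm_row_isometry.
Qed.

Lemma cp_map_linear i Y : linear Y -> linear (cp_map T i Y).
Proof.
move=> Ylin a x y; rewrite /cp_map scaler_sumr -big_split; apply: eq_bigr => j _ /=.
by rewrite (adj_linear j) Ylin (ri_linear Tri).
Qed.

Lemma defect_on_linear s Y : linear Y -> linear (defect_on s Y).
Proof.
move=> Ylin; elim: s => //= i s IHs a x y.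
by rewrite IHs (cp_map_linear i IHs) scalerBr opprD addrACA.
Qed.

Definition bounded_map (Y : G -> G) :=
  exists2 C : R[i], 0 <= C & forall x, `|Y x| <= C * `|x|.

Lemma bounded_defect_on s Y : bounded_map Y -> bounded_map (defect_on s Y).
Proof.
move=> Yb; elim: s => //= i s [C C0 Cb].
exists (C + \sum_(j < n i) C); first by rewrite addr_ge0// sumr_ge0.
move=> x; apply: le_trans (ler_normB _ _) _; rewrite mulrDl lerD//.
apply: le_trans (ler_norm_sum _ _ _) _; rewrite mulr_suml; apply: ler_sum => j _.
rewrite norm_row_isometry; apply: le_trans (Cb _) _; apply: ler_wpM2l => //.
exact: adj_norm.
Qed.

Lemma cp_mapB i Y Z x : cp_map T i (fun y => Y y - Z y) x = cp_map T i Y x - cp_map T i Z x.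
Proof.
by rewrite /cp_map -sumrB; apply: eq_bigr => j _; rewrite (linmapB (ri_linear Tri j)).
Qed.

Lemma cp_map_comm i l Y x : cp_map T i (cp_map T l Y) x = cp_map T l (cp_map T i Y) x.
Proof.
have [->//|il] := eqVneq i l.
rewrite /cp_map; under eq_bigr do rewrite (linmap_sum (ri_linear Tri _)).
under [RHS]eq_bigr do rewrite (linmap_sum (ri_linear Tri _)).
rewrite exchange_big /=; apply: eq_bigr => m _; apply: eq_bigr => j _.
by rewrite (ri_comm Tri)// adj_comm// eq_sym.
Qed.

Lemma defect_on_swap i l s Y : defect_on [:: i, l & s] Y = defect_on [:: l, i & s] Y.
Proof.
apply/funext => x /=; rewrite !cp_mapB (cp_map_comm i l).
by rewrite opprD addrACA -opprD.
Qed.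

Lemma defect_on_rem i s Y : i \in s -> defect_on s Y = defect_on (i :: rem i s) Y.
Proof.
elim: s => // a s IHs; rewrite inE eq_sym [rem _ _]/=.
have [->//|ai /= /IHs E] := eqVneq a i.
transitivity (defect_on [:: a, i & rem i s] Y); last exact: defect_on_swap.
by rewrite [LHS]/= E.
Qed.

Lemma defect_on_perm s t Y : perm_eq s t -> defect_on s Y = defect_on t Y.
Proof.
elim: s t => [|a s IHs] t st; first by move: st; rewrite perm_sym => /perm_nilP ->.
have at_ : a \in t by rewrite -(perm_mem st) mem_head.
rewrite (defect_on_rem Y at_) /= (IHs (rem a t))//.
by rewrite -(perm_cons a) (perm_trans st)// perm_to_rem.
Qed.

Lemma adj_wandering_proj i (j : 'I_(n i)) x : adjoint (T j) (wandering_proj i x) = 0.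
Proof.
rewrite (linmapB (adj_linear j)) /cp_map (linmap_sum (adj_linear j)).
rewrite (bigD1 j)//= (ri_orth Tri) eqxx big1 ?addr0 ?subrr// => m mj.
by rewrite (ri_orth Tri) eq_sym (negbTE mj).
Qed.

(** If [x] is orthogonal to the row [l] then, on [u = T i j x], the form of the
    defect of the two rows is minus the sum of the squared norms of the
    [adjoint (T l m) u], because the terms of [dot u u] cancel. Positivity
    therefore makes [u] orthogonal to the row [l] as well, and the general case
    follows by splitting a vector along the row [l]. *)
Lemma doubly_commuting_of_positive :
  (forall i l, i != l -> positive_op (defect_on [:: i; l] idfun)) -> doubly_commuting.
Proof.
move=> pos.
have key i l (j : 'I_(n i)) (m : 'I_(n l)) x : i != l ->
    (forall m' : 'I_(n l), adjoint (T m') x = 0) -> adjoint (T m) (T j x) = 0.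
  move=> il x0; have := pos i l il (T j x).
  have Zx : x - cp_map T l idfun x = x.
    by rewrite /cp_map big1 ?subr0// => m' _; rewrite /= x0 (linmap0 (ri_linear Tri _)).
  have Z0 : 0 - cp_map T l idfun 0 = 0.
    rewrite /cp_map big1 ?subr0// => m' _.
    by rewrite (linmap0 (adj_linear _)) /= (linmap0 (ri_linear Tri _)).
  have -> : defect_on [:: i; l] idfun (T j x) = - cp_map T l idfun (T j x).
    rewrite /= {2}/cp_map (bigD1 j)//= (ri_orth Tri) eqxx Zx big1 ?addr0.
      by rewrite addrAC subrr add0r.
    by move=> j' j'j; rewrite (ri_orth Tri) (negbTE j'j) Z0 (linmap0 (ri_linear Tri _)).
  rewrite dotNl oppr_ge0 dot_suml => le0; apply/eqP; rewrite -dot_eq0.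
  have ge0 (m' : 'I_(n l)) :
      0 <= dot (T m' (adjoint (T m') (T j x))) (T j x).
    by rewrite (ri_adjoint Tri) dot_ge0.
  have sum0 : \sum_(m' < n l) dot (T m' (adjoint (T m') (T j x))) (T j x) = 0.
    by apply/le_anti; rewrite le0 sumr_ge0.
  move/eqP: sum0; rewrite psumr_eq0 => [/allP/(_ m (mem_index_enum _))|//].
  by rewrite (ri_adjoint Tri).
move=> i l j m x il.
have k0 : adjoint (T m) (T j (wandering_proj l x)) = 0.
  by apply: key => // m'; exact: adj_wandering_proj.
have k1 := adj_wandering_proj m x.
have := subrK (cp_map T l idfun x) x; rewrite -/(wandering_proj l x).
move: (wandering_proj l x) k0 k1 => p k0 k1 <-.
rewrite (linmapD (ri_linear Tri j)) !(linmapD (adj_linear m)).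
rewrite k0 k1 (linmapD (ri_linear Tri j)) (linmap0 (ri_linear Tri j)) !add0r.
rewrite /cp_map (linmap_sum (ri_linear Tri j)).
rewrite !(linmap_sum (adj_linear m)) (linmap_sum (ri_linear Tri j)).
apply: eq_bigr => m' _; rewrite (ri_comm Tri)// !(ri_orth Tri).
by case: eqP => // _; rewrite (linmap0 (ri_linear Tri j)).
Qed.

End RowIsometries.

(** * The wandering subspace of a doubly commuting tuple *)

Section Multiwords.
Context (k : nat) (n : 'I_k -> nat).
Implicit Types (w : multiword n).

Definition empty_word : multiword n := [ffun i => [::]].

Lemma prependE i (j : 'I_(n i)) w : prepend j w i = j :: w i.
Proof. exact: set_wordE. Qed.

Lemma set_word_out w i l (u : seq 'I_(n i)) : i != l -> set_word w u l = w l.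
Proof. by move=> il; rewrite /set_word ffunE eqtype.dfwith_out. Qed.

Lemma prepend_out i l (j : 'I_(n i)) w : i != l -> prepend j w l = w l.
Proof. exact: set_word_out. Qed.

Lemma prepend_behead w i (j : 'I_(n i)) u : w i = j :: u ->
  w = prepend j (set_word w u).
Proof. by move=> wi; rewrite /prepend set_wordE set_word_set -wi set_word_id. Qed.

Lemma set_word_prepend i (j : 'I_(n i)) w : set_word (prepend j w) (w i) = w.
Proof. by rewrite /prepend set_word_set set_word_id. Qed.

(** Induction on the total length of a multiword. *)
Lemma multiword_ind (P : multiword n -> Prop) :
  P empty_word -> (forall i (j : 'I_(n i)) w, P w -> P (prepend j w)) ->
  forall w, P w.
Proof.
move=> P0 PS w; have [m] := ubnP (\sum_i size (w i))%N.
elim: m w => // m IHm w wm.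
have [/forallP w0|/forallPn[a]] := boolP [forall i, w i == [::]].
  suff -> : w = empty_word by [].
  by apply/ffunP => i; rewrite ffunE; exact/eqP.
case wa : (w a) => [//|j u] _.
rewrite (prepend_behead wa); apply: PS; apply: IHm; move: wm.
rewrite ltnS (bigD1 a)//= [X in (_ -> X < _)%N](bigD1 a)//= set_wordE wa /=.
rewrite addSn; apply: leq_ltn_trans; rewrite leq_add2l leq_eqVlt; apply/orP; left.
by apply/eqP/eq_bigr => l la; rewrite set_word_out// eq_sym.
Qed.

End Multiwords.

Section WanderingSubspace.
Context (R : realType) (k : nat) (n : 'I_k -> nat) (G : hilbertType R).
Context (T : op_tuple n G).
Hypotheses (Tri : row_isometries T) (Tdc : doubly_commuting T).
Hypothesis Tpure : completely_pure T.
Implicit Types (x y h : G) (i l : 'I_k) (s : seq 'I_k) (w v : multiword n).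

Local Notation D s := (defect_on T s idfun).

Lemma adj_comm_shift i l (j : 'I_(n i)) (m : 'I_(n l)) x : i != l ->
  adjoint (T j) (T m x) = T m (adjoint (T j) x).
Proof. by move=> il; rewrite Tdc// eq_sym. Qed.

Lemma defect_id_linear s : linear (D s).
Proof. by apply: defect_on_linear. Qed.

Lemma defect_id_comm s i (j : 'I_(n i)) x : i \notin s -> D s (T j x) = T j (D s x).
Proof.
elim: s x => //= l s IHs x; rewrite inE negb_or => /andP[il is_].
rewrite (linmapB (ri_linear Tri j)) /cp_map (linmap_sum (ri_linear Tri j)) IHs//.
congr (_ - _); apply: eq_bigr => m _.
by rewrite Tdc// IHs// (ri_comm Tri m j)// eq_sym.
Qed.

(** For doubly commuting rows the defect is a product of the commuting
    projections [wandering_proj T l]. *)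
Lemma defect_id_consr s l x : l \notin s -> D (l :: s) x = D s (wandering_proj T l x).
Proof.
move=> ls /=; rewrite (linmapB (defect_id_linear s)) /cp_map (linmap_sum (defect_id_linear s)).
by congr (_ - _); apply: eq_bigr => m _; rewrite /= defect_id_comm.
Qed.

Lemma defect_id_selfadj s x y : uniq s -> dot (D s x) y = dot x (D s y).
Proof.
elim: s x y => // l s IHs x y /= /andP[ls us].
rewrite dotBl dotBr IHs// dot_suml dot_sumr; congr (_ - _); apply: eq_bigr => m _.
by rewrite (ri_adjoint Tri) (dot_adj Tri) IHs.
Qed.

Lemma defect_id_adj_comm s i (j : 'I_(n i)) x : uniq s -> i \notin s ->
  D s (adjoint (T j) x) = adjoint (T j) (D s x).
Proof.
move=> us is_; apply: dotr_inj => y.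
by rewrite -defect_id_selfadj// -!(ri_adjoint Tri) -defect_id_selfadj// defect_id_comm.
Qed.

Lemma defect_id_consl s l x : l \notin s -> uniq s -> D (l :: s) x = wandering_proj T l (D s x).
Proof.
move=> ls us; rewrite /= /wandering_proj; congr (_ - _).
by apply: eq_bigr => m _; rewrite defect_id_adj_comm.
Qed.

Lemma adj_defect_id s i (j : 'I_(n i)) x : uniq s -> i \in s -> adjoint (T j) (D s x) = 0.
Proof.
elim: s x => // l s IHs x /andP[ls us]; rewrite inE => /orP[/eqP E|is_].
  by subst l; rewrite defect_id_consl// (adj_wandering_proj Tri).
by rewrite defect_id_consr// IHs.
Qed.

(** The totality of the translates of the wandering subspace, with their
    orthogonal complement replaced by a set [K] invariant under all adjoints.
    If the defect of [l :: s] kills [K], then the image of [K] under the defect of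
    [s] meets the hypotheses of purity for the row [l], hence is zero; rows are
    peeled off in this way until the defect is the identity. *)
Lemma wandering_total_on s (K : set G) : uniq s ->
  (forall i (j : 'I_(n i)) x, K x -> K (adjoint (T j) x)) ->
  (forall x, K x -> D s x = 0) -> forall x, K x -> x = 0.
Proof.
elim: s => [|l s IHs] /= us Kadj K0 x Kx; first exact: K0.
move: us => /andP[ls us]; apply: IHs Kx => // {}x Kx.
apply: (@Tpure l (D s @` K)); last by exists x.
  by move=> j _ [y Ky <-]; exists (adjoint (T j) y); [exact: Kadj|rewrite defect_id_adj_comm].
by move=> _ [y Ky <-]; rewrite -defect_id_consl//; exact: K0.
Qed.

Lemma word_op_comm i l (j : 'I_(n i)) (u : seq 'I_(n l)) x : i != l ->
  T j (word_op T u x) = word_op T u (T j x).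
Proof. by move=> il; elim: u => //= m u IHu; rewrite (ri_comm Tri)// IHu. Qed.

Lemma multiword_op_prepend i (j : 'I_(n i)) w x :
  multiword_op T (prepend j w) x = T j (multiword_op T w x).
Proof.
rewrite /multiword_op; pose f v s := foldr (fun l A => word_op T (v l) \o A) idfun s.
have out s : i \notin s -> f (prepend j w) s x = f w s x /\
    T j (f w s x) = f w s (T j x).
  elim: s => //= l s IHs; rewrite inE negb_or => /andP[il /IHs[E1 E2]].
  by rewrite E1 prepend_out// word_op_comm// E2.
suff into s : uniq s -> i \in s -> f (prepend j w) s x = T j (f w s x).
  by apply: into; rewrite ?enum_uniq// mem_enum.
elim: s => //= l s IHs /andP[ls us]; rewrite inE.
have [E _|il /= is_] := eqVneq i l.
  by subst l; rewrite (out s ls).1 prependE.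
by rewrite IHs// prepend_out// word_op_comm.
Qed.

Lemma multiword_op_empty x : multiword_op T (empty_word n) x = x.
Proof.
by rewrite /multiword_op; elim: (enum _) => //= l s ->; rewrite ffunE.
Qed.

Lemma multiword_op_linear w : linear (multiword_op T w).
Proof.
elim/multiword_ind: w => [|i j w IHw] a x y; first by rewrite !multiword_op_empty.
by rewrite !multiword_op_prepend IHw (ri_linear Tri).
Qed.

(** Vectors of the wandering subspace: [defect T idfun] maps onto it when [T] is
    doubly commuting. *)
Definition wandering h := forall i (j : 'I_(n i)), adjoint (T j) h = 0.

(** The backward shifts act on [multiword_op T w h] as on an elementary tensor:
    letters of the row [i] are removed, and if there is none the adjoint passes
    through the other rows and kills [h]. *)
Lemma adj_multiword_op i (j : 'I_(n i)) w h : wandering h ->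
  adjoint (T j) (multiword_op T w h) =
    if w i is j' :: u then if j' == j then multiword_op T (set_word w u) h else 0
    else 0.
Proof.
move=> h0; case wi : (w i) => [|j' u].
  elim/multiword_ind: w wi => [|l m w IHw] wi; first by rewrite multiword_op_empty h0.
  rewrite multiword_op_prepend; have [E|il] := eqVneq i l.
    by subst l; rewrite prependE in wi.
  rewrite adj_comm_shift// IHw ?(linmap0 (ri_linear Tri m))//.
  by rewrite prepend_out// eq_sym in wi.
rewrite {1}(prepend_behead wi) multiword_op_prepend (ri_orth Tri) eq_sym.
by case: eqP.
Qed.

Lemma dot_multiword_op v w g h : wandering g -> wandering h ->
  dot (multiword_op T v g) (multiword_op T w h) = if v == w then dot g h else 0.
Proof.
move=> g0 h0; elim/multiword_ind: v w => [|i j v IHv] w.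
  rewrite multiword_op_empty; elim/multiword_ind: w => [|i j w _].
    by rewrite multiword_op_empty eqxx.
  rewrite multiword_op_prepend (dot_adj Tri) g0 dot0l; case: eqP => // /ffunP/(_ i).
  by rewrite prependE ffunE.
rewrite multiword_op_prepend (ri_adjoint Tri) adj_multiword_op//.
case wi : (w i) => [|j' u].
  by rewrite dot0r; case: eqP => // E; rewrite -E prependE in wi.
have [E|jj'] := eqVneq j' j; last first.
  rewrite dot0r; case: eqP => // E; rewrite -E prependE in wi.
  by case: wi jj' => ->; rewrite eqxx.
subst j'; rewrite IHv; congr (if _ then _ else _).
apply/eqP/eqP => [->|E]; first exact: esym (prepend_behead wi).
by move: wi; rewrite -E prependE => -[<-]; rewrite set_word_prepend.
Qed.

End WanderingSubspace.

(** * The Euler characteristic of a pure doubly commuting tuple *)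

Section BoundedWords.
Context (k : nat) (n : 'I_k -> nat) (q : 'I_k -> nat).

(** Multiwords with [i]-th component of length at most [q i], as a finite type
    whose cardinal can be computed. *)
Definition bounded_words : finType :=
  {dffun forall i : 'I_k, {p : 'I_(q i).+1 & p.-tuple 'I_(n i)}}.

Definition word_of (b : bounded_words) : multiword n :=
  [ffun i => tval (tagged (b i))].

Lemma card_bounded_words : #|bounded_words| = (\prod_(i < k) \sum_(p < (q i).+1) n i ^ p)%N.
Proof.
rewrite card_dep_ffun foldrE big_map big_enum /=; apply: eq_bigr => i _.
rewrite card_tagged sumnE big_map big_enum /=; apply: eq_bigr => p _.
by rewrite card_tuple card_ord.
Qed.

Lemma word_of_inj : injective word_of.
Proof.
move=> b c /ffunP bc; apply/ffunP => i; have := bc i; rewrite !ffunE.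
case: (b i) (c i) => [p u] [p' u'] /= E.
have pp : p = p' by apply: val_inj; rewrite /= -(size_tuple u) -(size_tuple u') E.
by subst p'; congr Tagged; apply: val_inj.
Qed.

Lemma size_word_of b i : (size (word_of b i) <= q i)%N.
Proof. by rewrite ffunE size_tuple -ltnS. Qed.

Lemma word_of_onto (w : multiword n) : (forall i, size (w i) <= q i)%N ->
  exists b, word_of b = w.
Proof.
move=> wq; have wq' i : (size (w i) < (q i).+1)%N by rewrite ltnS.
pose b : bounded_words := [ffun i : 'I_k =>
  Tagged (fun p : 'I_(q i).+1 => p.-tuple 'I_(n i)) (in_tuple (w i) : (Ordinal (wq' i)).-tuple _)].
by exists b; apply/ffunP => i; rewrite !ffunE.
Qed.

End BoundedWords.

Section EulerCharacteristic.
Context (R : realType) (k : nat) (n : 'I_k -> nat) (G : hilbertType R).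
Context (T : op_tuple n G).
Hypotheses (Tri : row_isometries T) (Tdc : doubly_commuting T).
Hypothesis Tpure : completely_pure T.
Context (d : nat) (e : 'I_d -> G).
Hypotheses (eo : orthonormal_family e).
Hypothesis eL : range (defect T idfun) = combinations e.

Lemma defect_wandering x : wandering T (defect T idfun x).
Proof.
by move=> i j; apply: (adj_defect_id Tri Tdc); rewrite ?enum_uniq ?mem_enum.
Qed.

Lemma wandering_basis a : wandering T (e a).
Proof.
have : range (defect T idfun) (e a) by rewrite eL; exact: mem_combinations.
by case=> x _ <-; exact: defect_wandering.
Qed.

(** The analogue in [G] of the standard basis of a tensor product of Fock spaces
    with a space of dimension [d]. *)
Definition wandering_family (p : multiword n * 'I_d) : G := multiword_op T p.1 (e p.2).

Lemma wandering_family_orthonormal : orthonormal_family wandering_family.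
Proof.
move=> [v a] [w b]; rewrite /wandering_family (dot_multiword_op Tri Tdc)/=;
  try exact: wandering_basis.
by rewrite eo xpair_eqE; case: eqP.
Qed.

Lemma wandering_family_total : total_family wandering_family.
Proof.
move=> x xE.
pose K := [set y | forall w h, range (defect T idfun) h -> dot y (multiword_op T w h) = 0].
apply: (@wandering_total_on _ _ _ _ _ Tri Tdc Tpure (enum 'I_k) K).
- exact: enum_uniq.
- by move=> i j y Ky w h hL; rewrite -(dot_adj Tri) -(multiword_op_prepend Tri) Ky.
- move=> y Ky; apply: dot_inj => z; rewrite (defect_id_selfadj Tri) ?enum_uniq// dot0l.
  by rewrite -(multiword_op_empty T (defect_on _ _ _ _)) Ky//; exists z.
- move=> w h; rewrite eL => -[c _ <-].
  rewrite (linmap_sum (multiword_op_linear Tri w)) dot_sumr big1// => a _.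
  by rewrite (linmapZ (multiword_op_linear Tri w)) dotZr (xE (w, a)) mulr0.
Qed.

(** The translates of an orthonormal basis of the wandering subspace by words of
    length at most [q] span the Euler space and are orthonormal. *)
Lemma euler_space_dim q :
  lin_dim (euler_space T q) = ((\prod_(i < k) \sum_(p < (q i).+1) n i ^ p) * d)%N.
Proof.
pose b (p : bounded_words n q * 'I_d) := wandering_family (word_of p.1, p.2).
have bo : orthonormal_family b.
  move=> [u a] [v c]; rewrite wandering_family_orthonormal !xpair_eqE /=.
  by rewrite (inj_eq (@word_of_inj _ _ _)).
have <- : #|{: bounded_words n q * 'I_d}| =
    ((\prod_(i < k) \sum_(p < (q i).+1) n i ^ p) * d)%N.
  by rewrite card_prod card_bounded_words card_ord.
apply: lin_dimE; suff -> : euler_space T q = combinations b.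
  exact/has_dim_combinations/orthonormal_independent.
have bs := combinations_subspace b.
apply/seteqP; split.
  apply: smallest_sub => // _ [w [h [wq hL ->]]].
  have [u uw] := word_of_onto wq; move: hL; rewrite eL => -[c _ <-].
  rewrite (linmap_sum (multiword_op_linear Tri w)); apply: subspace_sum => // a _.
  rewrite (linmapZ (multiword_op_linear Tri w)) -[_ *: _]addr0; apply: bs.2 bs.1.
  by have := mem_combinations b (u, a); rewrite /b /wandering_family /= uw.
apply: combinations_sub.
  split=> [V [Vs _]|c x y Vx Vy V VA]; first exact: Vs.1.
  by apply: VA.1.2; [exact: Vx|exact: Vy].
move=> [u a] V [_ VA]; apply: VA; exists (word_of u), (e a); split=> //.
  exact: size_word_of.
by rewrite eL; exact: mem_combinations.
Qed.

(** The Euler ratio is constant, equal to the dimension of the wandering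
    subspace. *)
Lemma euler_characteristicE : euler_characteristic T = d%:R.
Proof.
have ratioE q : euler_ratio T q = d%:R.
  rewrite /euler_ratio euler_space_dim natrM mulrAC divff ?mul1r// pnatr_eq0 -lt0n.
  by apply: prodn_gt0 => i; rewrite big_ord_recl expn0.
have chi : is_euler_characteristic T (d%:R : R).
  by move=> q _ _; under eq_fun do rewrite ratioE; exact: cvg_cst.
pose diag (m : nat) (_ : 'I_k) := m.
have diag_mono m m' : (m <= m')%N -> forall i, (diag m i <= diag m' i)%N by [].
have diag_cofinal (p : 'I_k -> nat) : exists m, forall i, (p i <= diag m i)%N.
  by exists (\max_i p i)%N => i; exact: leq_bigmax.
apply: xget_unique => // c /(_ diag diag_mono diag_cofinal) cP.
exact: cvg_unique cP (chi diag diag_mono diag_cofinal).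
Qed.

End EulerCharacteristic.

(** * Unitary equivalence of pure doubly commuting tuples *)

Section UnitaryEquivalence.
Context (R : realType) (k : nat) (n : 'I_k -> nat) (G K : hilbertType R).
Context (T : op_tuple n G) (S : op_tuple n K).
Hypotheses (Tri : row_isometries T) (Sri : row_isometries S).

Definition intertwined := exists U : {linear G -> K},
  [/\ bijective U, forall x y, dot (U x) (U y) = dot x y
    & forall i (j : 'I_(n i)) x, U (T j x) = S j (U x)].

(** A unitary that intertwines the tuples also intertwines the adjoints, hence
    the defects. *)
Lemma intertwined_defect_dim d : intertwined ->
  has_dim (range (defect T idfun)) d -> has_dim (range (defect S idfun)) d.
Proof.
move=> [U [[V UV VU] Udot UT]] Td.
have Uadj i (j : 'I_(n i)) x : adjoint (S j) (U x) = U (adjoint (T j) x).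
  apply: dotr_inj => z; rewrite -(VU z) -(ri_adjoint Sri) -UT !Udot.
  exact: ri_adjoint.
have Ulin : linear U by move=> a x y; rewrite linearP.
have Udefect x : U (defect T idfun x) = defect S idfun (U x).
  rewrite /defect; elim: (enum _) x => //= i s IHs x.
  rewrite (linmapB Ulin) IHs (linmap_sum Ulin); congr (_ - _).
  by apply: eq_bigr => j _; rewrite UT IHs Uadj.
have -> : range (defect S idfun) = U @` range (defect T idfun).
  apply/seteqP; split=> [_ [y _ <-]|_ [_ [x _ <-] <-]].
    by exists (defect T idfun (V y)); [exists (V y)|rewrite Udefect VU].
  by exists (U x) => //; rewrite Udefect.
by apply/has_dim_image => //; exact: can_inj UV.
Qed.

Hypotheses (Tdc : doubly_commuting T) (Sdc : doubly_commuting S).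
Hypotheses (Tpure : completely_pure T) (Spure : completely_pure S).

(** The unitary that matches the two wandering families intertwines the tuples
    because the adjoints act on both families by the same rule. *)
Lemma intertwined_of_dim d : has_dim (range (defect T idfun)) d ->
  has_dim (range (defect S idfun)) d -> intertwined.
Proof.
move=> /orthonormal_basis[e [eo eL]] /orthonormal_basis[f [fo fL]].
have ew := wandering_basis Tri Tdc eL; have fw := wandering_basis Sri Sdc fL.
have Etotal := wandering_family_total Tri Tdc Tpure eL.
have Ftotal := wandering_family_total Sri Sdc Spure fL.
have [U [Ubij Udot UE]] := unitary_of_bases
  (wandering_family_orthonormal Tri Tdc eo eL)
  (wandering_family_orthonormal Sri Sdc fo fL) Etotal Ftotal.
exists U; split=> // i j x; apply: (total_inj Ftotal) => -[w a].
rewrite UE /wandering_family /= (ri_adjoint Tri) (ri_adjoint Sri).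
rewrite (adj_multiword_op Tri Tdc)// (adj_multiword_op Sri Sdc)//.
case: (w i) => [|j' u]; first by rewrite !dot0r.
case: eqP => _; last by rewrite !dot0r.
by rewrite (UE x (set_word w u, a)).
Qed.

Theorem intertwined_iff_euler :
  finite_rank (defect T idfun) -> finite_rank (defect S idfun) ->
  intertwined <-> euler_characteristic T = euler_characteristic S.
Proof.
move=> [d Td] [d' Sd'].
have [e [eo eL]] := orthonormal_basis Td; have [f [fo fL]] := orthonormal_basis Sd'.
rewrite (euler_characteristicE Tri Tdc eo eL) (euler_characteristicE Sri Sdc fo fL).
split=> [TS|/eqP]; first by rewrite (has_dim_unique (intertwined_defect_dim TS Td) Sd').
by rewrite eqr_nat => /eqP E; subst d'; exact: intertwined_of_dim Td Sd'.
Qed.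

End UnitaryEquivalence.

(** * Restriction to an invariant subspace, and positivity of partial defects *)

Section Restriction.
Context (R : realType) (k : nat) (n : 'I_k -> nat) (F : hilbertType R).
Context (S : op_tuple n F) (Sri : row_isometries S).
Context (M : closed_subspace F) (invM : invariant_for S (carrier M)).

Local Notation T := (restrict_tuple invM).
Local Notation G := (subspace_type M).

Definition proj_to (x : F) : G := subspace_vec (orth_proj_in M x).

Lemma proj_to_val (y : G) : proj_to (val y) = y.
Proof. by apply: val_inj; rewrite /= orth_proj_id//; exact: subspace_valP. Qed.

Lemma dot_proj_to x (y : G) : dot (proj_to x) y = dot x (val y).
Proof.
rewrite -(dot_orth_proj x (subspace_valP y)); reflexivity.
Qed.

Lemma adjoint_restrict i (j : 'I_(n i)) (y : G) :
  adjoint (T j) y = proj_to (adjoint (S j) (val y)).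
Proof.
suff -> : adjoint (T j) = fun y : G => proj_to (adjoint (S j) (val y)) by [].
apply: adjoint_unique => x z.
by rewrite [RHS]dotC dot_proj_to -dotC -(ri_adjoint Sri).
Qed.

(** Since [M] is invariant for [S], its orthogonal complement is invariant for
    the adjoints, so compressing commutes with taking adjoints. *)
Lemma adjoint_restrict_proj i (j : 'I_(n i)) x :
  adjoint (T j) (proj_to x) = proj_to (adjoint (S j) x).
Proof.
rewrite adjoint_restrict; apply: dot_inj => z; rewrite !dot_proj_to.
by rewrite -!(dot_adj Sri) dot_orth_proj//; apply: invM; exact: subspace_valP.
Qed.

Lemma restrict_row_isometries : row_isometries T.
Proof.
split.
- by move=> i j a x y; apply: val_inj; rewrite [RHS]linearP -(ri_linear Sri) -linearP.
- move=> i j x y; rewrite adjoint_restrict [RHS]dotC dot_proj_to -dotC -(ri_adjoint Sri).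
  by [].
- move=> i j m x; rewrite adjoint_restrict /= (ri_orth Sri).
  case: eqP => _; first exact: proj_to_val.
  by apply: dot_inj => z; rewrite dot_proj_to !dot0l.
- by move=> i l j m x il; apply: val_inj; rewrite /= (ri_comm Sri).
Qed.

(** The defect operator of [M] is the defect of the restricted tuple, extended by
    zero on the orthogonal complement of [M]. *)
Lemma defect_restrict s x :
  defect_on S s (orth_proj M) x = val (defect_on T s idfun (proj_to x)).
Proof.
have vl : linear (val : G -> F) by move=> a y z; rewrite linearP.
elim: s x => [//|i s IHs] x; rewrite [LHS]/= [defect_on T _ _ _]/=.
rewrite [RHS](linmapB vl) /cp_map [X in _ = _ - X](linmap_sum vl) IHs.
by congr (_ - _); apply: eq_bigr => j _; rewrite IHs adjoint_restrict_proj.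
Qed.

Lemma positive_defect_restrict s : positive_op (defect_on S s (orth_proj M)) ->
  positive_op (defect_on T s idfun).
Proof. by move=> pos y; have := pos (val y); rewrite defect_restrict proj_to_val. Qed.

Lemma finite_rank_restrict : finite_rank (defect S (orth_proj M)) ->
  finite_rank (defect T idfun).
Proof.
move=> [d dP]; exists d.
have vl : linear (val : G -> F) by move=> a x y; rewrite linearP.
apply/(has_dim_image _ _ vl val_inj); move: dP.
congr has_dim; apply/seteqP; split=> [_ [x _ <-]|_ [_ [y _ <-] <-]].
  by exists (defect T idfun (proj_to x)); [exists (proj_to x)|rewrite -defect_restrict].
by exists (val y) => //; rewrite [LHS]defect_restrict proj_to_val.
Qed.

End Restriction.

Section Positivity.
Context (R : realType) (k : nat) (n : 'I_k -> nat) (G : hilbertType R).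
Context (T : op_tuple n G) (Tri : row_isometries T).

Fixpoint nilpotent_at i m (x : G) : Prop :=
  if m is m'.+1 then forall j : 'I_(n i), nilpotent_at i m' (adjoint (T j) x)
  else x = 0.

Definition dense_nilpotent := forall i x (e : R[i]), 0 < e ->
  exists m x', nilpotent_at i m x' /\ `|x - x'| <= e.

Hypothesis Tnil : dense_nilpotent.

(** On a vector killed by all products of [m] adjoints, iterating
    [Y x = (Y x - cp_map T i Y x) + cp_map T i Y x] ends after [m] steps and shows
    that the form of [Y] is a sum of nonnegative terms; such vectors are dense and
    [Y] is bounded. *)
Lemma positive_sub_cp_map i Y : linear Y -> bounded_map Y ->
  positive_op (fun x => Y x - cp_map T i Y x) -> positive_op Y.
Proof.
move=> Ylin [C C0 YC] pos.
have nil m x : nilpotent_at i m x -> 0 <= dot (Y x) x.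
  elim: m x => [x ->|m IHm x nx]; first by rewrite dot0r.
  have -> : dot (Y x) x = dot (Y x - cp_map T i Y x) x + dot (cp_map T i Y x) x.
    by rewrite -dotDl subrK.
  apply: addr_ge0; first exact: (pos x).
  rewrite dot_suml sumr_ge0// => j _; rewrite (ri_adjoint Tri).
  exact/IHm/nx.
move=> x; apply: ge0_of_approx => e e0.
(* For |x - x'| <= t <= 1 the two values of the form differ by at most A * t;
   t = e / (e + A) makes t <= 1 and A * t <= e. *)
pose A := C * (2 * `|x| + 1).
have A0 : 0 <= A by rewrite mulr_ge0// addr_ge0// mulr_ge0.
have eA0 : 0 < e + A by rewrite ltr_wpDr.
have [|m [x' [nx' xx']]] := Tnil i x (e := e / (e + A)); first by rewrite divr_gt0.
exists (dot (Y x') x'); split; first exact: nil nx'.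
have -> : dot (Y x) x - dot (Y x') x' = dot (Y x) (x - x') + dot (Y (x - x')) x'.
  by rewrite (linmapB Ylin) dotBr dotBl addrA subrK.
set t := e / (e + A) in xx'.
have t1 : t <= 1 by rewrite ler_pdivrMr// mul1r lerDl.
have x'x : `|x'| <= `|x| + 1.
  rewrite -(subrK x x') addrC; apply: le_trans (ler_normD _ _) _.
  by rewrite lerD2l distrC (le_trans xx').
apply: (@le_trans _ _ (C * `|x| * t + C * t * (`|x| + 1))).
  apply: le_trans (ler_normD _ _) _; apply: lerD.
    apply: le_trans (Cauchy_Schwarz _ _) _; apply: ler_pM => //.
  apply: le_trans (Cauchy_Schwarz _ _) _; apply: ler_pM => //.
  by apply: le_trans (YC _) _; apply: ler_wpM2l.
have -> : C * `|x| * t + C * t * (`|x| + 1) = A * t by rewrite /A; ring.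
by rewrite /t mulrCA ger_pMr// ler_pdivrMr// mul1r lerDr ltW.
Qed.

Lemma positive_defect_cat s1 s2 Y : linear Y -> bounded_map Y ->
  positive_op (defect_on T (s1 ++ s2) Y) -> positive_op (defect_on T s2 Y).
Proof.
move=> Ylin Yb; elim: s1 => //= i s IHs pos; apply: IHs.
apply: positive_sub_cp_map pos; first exact: defect_on_linear.
exact: bounded_defect_on.
Qed.

(** A positive defect stays positive when rows are dropped, and any row can be
    moved to the front to be dropped. *)
Lemma positive_defect_pair i l Y : linear Y -> bounded_map Y -> i != l ->
  positive_op (defect T Y) -> positive_op (defect_on T [:: i; l] Y).
Proof.
move=> Ylin Yb il.
pose s := [seq a <- enum 'I_k | (a != i) && (a != l)].
change (defect T Y) with (defect_on T (enum 'I_k) Y).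
rewrite (@defect_on_perm _ _ _ _ _ Tri _ (s ++ [:: i; l])); first exact: positive_defect_cat.
apply: uniq_perm; first exact: enum_uniq.
  rewrite cat_uniq filter_uniq ?enum_uniq//= !inE il orbF !mem_filter eqxx /= andbT.
  by rewrite eqxx andbF.
move=> a; rewrite mem_enum mem_cat mem_filter mem_enum !inE /= andbT.
by case: eqP => //=; case: eqP.
Qed.

End Positivity.

(** * The shifts on the Fock space *)

Section FockShifts.
Context (R : realType) (k : nat) (n : 'I_k -> nat) (H : hilbertType R).
Implicit Types (f g : fock n H) (w v : multiword n) (i l : 'I_k).

Local Notation S := (fock_shift n H).
Local Notation shift j := (fock_shift n H _ j).
Local Notation psum := (@summability.partial_sum (multiword n) R[i]^o).
Local Existing Instance summability.totally_filter.

Lemma prepend_inj i (j : 'I_(n i)) : injective (prepend j).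
Proof.
move=> v w E; have := congr1 (fun u : multiword n => u i) E; rewrite !prependE => -[vw].
by rewrite -(set_word_prepend j v) E vw set_word_prepend.
Qed.

Lemma unshift_l2 i (j : 'I_(n i)) f :
  (fun w => f (prepend j w)) \in @square_summable_pred R (multiword n) H.
Proof.
have [M fM] := l2P f; apply/asboolP; exists M => J.
apply: le_trans (fM (prepend j @` J)%fset).
by rewrite big_imfset//= => v w _ _; exact: prepend_inj.
Qed.

Definition unshift i (j : 'I_(n i)) : fock n H -> fock n H :=
  fun f => L2 (unshift_l2 j f).

Lemma shift_prependE i (j m : 'I_(n i)) f w :
  shift j f (prepend m w) = if m == j then f w else 0.
Proof.
rewrite /= /shift_fun prependE; case: eqP => // mj.
by rewrite set_word_prepend.
Qed.

(** Both sides are limits of the same finite sums: a set [J] of indices for the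
    left side corresponds to the set [J'] of the words [v] with [prepend j v] in
    [J]. *)
Lemma dot_shift_unshift i (j : 'I_(n i)) f g :
  dot (shift j f) g = dot f (unshift j g).
Proof.
apply: l2_dotE; apply/(@cvgrPdist_lt _ R[i]^o) => e e0.
have /(@cvgrPdist_lt _ R[i]^o)/(_ e e0) := @l2_cvg_dot _ _ _ f (unshift j g).
move=> [J0 _ J0e]; exists (prepend j @` J0)%fset => // J /= /fsubsetP JJ.
pose isp (v : multiword n) := if v i is j' :: _ then j' == j else false.
pose tl (v : multiword n) := set_word v (behead (v i)).
have tlK v : isp v -> prepend j (tl v) = v.
  rewrite /isp /tl; case vi : (v i) => [//|j' u] /eqP E; subst j'.
  exact: esym (prepend_behead vi).
have prependK v : tl (prepend j v) = v.
  by rewrite /tl prependE set_word_prepend.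
pose J' := (tl @` [fset v in J | isp v])%fset.
have J0J' : (J0 `<=` J')%fset.
  apply/fsubsetP => v vJ0; apply/imfsetP; exists (prepend j v); rewrite /= ?prependK//.
  by rewrite !inE /isp prependE eqxx andbT; apply: JJ; exact: in_imfset.
suff -> : psum (fun v => dot (shift j f v) (g v)) J =
    psum (fun v => dot (f v) (unshift j g v)) J' by exact: J0e.
rewrite !psumE (big_fsetID _ isp) /= [X in _ + X]big_seq [X in _ + X]big1 ?addr0.
  rewrite [RHS]big_imfset /=; last first.
    by move=> v w; rewrite !inE /= => /andP[_ /tlK {2}<-] /andP[_ /tlK {2}<-] ->.
  rewrite big_seq [RHS]big_seq; apply: eq_bigr => v; rewrite !inE /= => /andP[_ vp].
  by rewrite tlK// -{1}(tlK v vp) shift_fun_prepend.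
move=> v; rewrite !inE /= /isp /shift_fun => /andP[_].
by case: (v i) => [|j' u]; rewrite ?dot0l// => /negbTE ->; rewrite dot0l.
Qed.

Lemma adjoint_shift i (j : 'I_(n i)) : adjoint (shift j) = unshift j.
Proof. by apply: adjoint_unique; exact: dot_shift_unshift. Qed.

Lemma prependC i l (j : 'I_(n i)) (m : 'I_(n l)) w : i != l ->
  prepend j (prepend m w) = prepend m (prepend j w).
Proof.
move=> il; apply/ffunP => a; have li : l != i by rewrite eq_sym.
have [E|ia] := eqVneq i a.
  by subst a; rewrite prependE !(prepend_out m _ li) prependE.
rewrite (prepend_out j _ ia); have [E|la] := eqVneq l a.
  by subst a; rewrite !prependE (prepend_out j _ ia).
by rewrite !(prepend_out m _ la) (prepend_out j _ ia).
Qed.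

Lemma fock_row_isometries : row_isometries S.
Proof.
split.
- move=> i j a f g; apply: dot_inj => h.
  by rewrite dotDl dotZl !dot_shift_unshift dotDl dotZl.
- by move=> i j f g; rewrite adjoint_shift dot_shift_unshift.
- move=> i j m f; rewrite adjoint_shift; apply/val_inj/funext => w.
  by rewrite [LHS]shift_prependE; case: eqP.
- move=> i l j m f il; apply: dot_inj => g; rewrite !dot_shift_unshift.
  by congr dot; apply/val_inj/funext => w; rewrite /= prependC.
Qed.

Lemma trunc_l2 i (m : nat) f :
  (fun w => if (size (w i) < m)%N then f w else 0)
    \in @square_summable_pred R (multiword n) H.
Proof.
have [M fM] := l2P f; apply/asboolP; exists M => J; apply: le_trans (fM J).
by apply: ler_sum => w _; case: ifP => // _; rewrite normr0 expr0n exprn_ge0.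
Qed.

Definition trunc i m f : fock n H := L2 (trunc_l2 i m f).

Lemma nilpotent_of_support i m f : (forall w, (m <= size (w i))%N -> f w = 0) ->
  nilpotent_at S i m f.
Proof.
elim: m f => [|m IHm] f f0 /=; first by apply/val_inj/funext => w; exact: f0.
move=> j; rewrite adjoint_shift; apply: IHm => w wm /=.
by rewrite f0// prependE.
Qed.

(** Truncating [f] to words with [i]-th component shorter than [m] gives a vector
    killed by products of [m] backward shifts, and the error is the tail of a
    convergent series. *)
Lemma fock_dense_nilpotent : dense_nilpotent S.
Proof.
move=> i f e e0; have [M fM] := l2P f.
have [|J|a [fa ua _]] := @cvg_psum_ge0 R (multiword n) (fun w => `|f w| ^+ 2) M.
- by move=> w; rewrite exprn_ge0.
- by rewrite psumE.
have e20 : 0 < e ^+ 2 by rewrite exprn_gt0.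
have /(@cvgrPdist_lt _ R[i]^o)/(_ _ e20) := fa.
move=> [J0 _ /(_ J0 (fsubset_refl _)) J0e].
(* All words of [J0] are shorter than [m]: truncating removes only terms outside
   [J0], whose sum is less than [e ^+ 2]. *)
pose m := (\max_(w <- J0) size (w i)).+1.
exists m, (trunc i m f); split.
  by apply: nilpotent_of_support => w; rewrite /= leqNgt => /negbTE ->.
have eE : e = (complex.Re e)%:C%C by rewrite RRe_real// ger0_real// ltW.
rewrite eE; apply: l2_norm_bound; first by rewrite -lecR -eE ltW.
move=> J; rewrite rmorphXn /= -eE.
apply: le_trans (ltW J0e); rewrite ger0_norm ?subr_ge0 ?ua//.
pose J' := [fset w in J | (m <= size (w i))%N]%fset.
have -> : \sum_(w <- J) `|(f - trunc i m f : l2 _ H) w| ^+ 2 = \sum_(w <- J') `|f w| ^+ 2.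
  transitivity (\sum_(w <- J) `|f w - (if (size (w i) < m)%N then f w else 0)| ^+ 2).
    by [].
  rewrite (big_fsetID _ (fun w : multiword n => m <= size (w i))%N) /=.
  rewrite [X in _ + X]big_seq [X in _ + X]big1 ?addr0; last first.
    move=> w; rewrite !inE /= -ltnNge => /andP[_ wm].
    by rewrite wm subrr normr0 expr0n.
  rewrite big_seq [RHS]big_seq; apply: eq_bigr => w; rewrite !inE /= => /andP[_ wm].
  by rewrite ltnNge wm /= subr0.
rewrite lerBrDl psumE.
have -> : J' = ((J0 `|` J') `\` J0)%fset.
  apply/fsetP => w; rewrite !inE /=; case: (boolP (w \in J0)) => //= wJ0.
  apply/negP => /andP[_]; rewrite /m ltnNge => /negP; apply.
  by rewrite (big_fsetD1 w)//= leq_maxl.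
by rewrite -big_fset_subD ?fsubsetUl// -(psumE (fun w => `|f w| ^+ 2)) ua.
Qed.

End FockShifts.

Section InvariantSubspaces.
Context (R : realType) (k : nat) (n : 'I_k -> nat) (H : hilbertType R).
Context (M : closed_subspace (fock n H)).
Context (invM : invariant_for (fock_shift n H) (carrier M)).

(** A vector of [K] is the sum of the shifts of its backward shifts. So its value
    at a word without letters of the row [l] is zero, and its value at a longer
    word is a value, at a shorter word, of another vector of [K]. *)
Lemma restrict_completely_pure : completely_pure (restrict_tuple invM).
Proof.
have Sri := fock_row_isometries n H.
have vl : linear (val : subspace_type M -> fock n H) by move=> a x y; rewrite linearP.
move=> l K Kadj K0.
have splitK (x : subspace_type M) : K x -> val x =
    \sum_(j < n l) fock_shift n H _ j (val (adjoint (restrict_tuple invM j) x)).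
  by move=> /K0/subr0_eq xE; rewrite {1}xE (linmap_sum vl).
have evl (w : multiword n) : linear (fun f : fock n H => f w) by [].
have pointwise0 u (w : multiword n) (x : subspace_type M) : w l = u -> K x ->
    (val x : fock n H) w = 0.
  elim: u w x => [|j u IHu] w x wl Kx;
    rewrite (splitK x Kx) (linmap_sum (evl w)) big1// => m _;
    rewrite /= /shift_fun wl//.
  case: eqP => // _; apply: (IHu (set_word w u)); first exact: set_wordE.
  exact: Kadj.
move=> x Kx; apply/val_inj; apply/val_inj/funext => w; exact: pointwise0.
Qed.

Lemma restrict_doubly_commuting :
  positive_op (defect (fock_shift n H) (orth_proj M)) ->
  doubly_commuting (restrict_tuple invM).
Proof.
have Sri := fock_row_isometries n H.
move=> pos; apply: (doubly_commuting_of_positive (restrict_row_isometries Sri invM)).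
move=> i l il; apply: (positive_defect_restrict Sri invM).
apply: (positive_defect_pair Sri) => //; first exact: fock_dense_nilpotent.
  exact: orth_proj_linear.
by exists 1 => [|x]; rewrite ?ler01// mul1r orth_proj_norm.
Qed.

End InvariantSubspaces.

(** * The classification *)

Theorem theorem2p3 (R : realType) (k : nat) (n : 'I_k -> nat)
    (k_gt0 : (0 < k)%N) (n_ge2 : forall i : 'I_k, (2 <= n i)%N)
    (H : hilbertType R)
    (M N : closed_subspace (fock n H))
    (invM : invariant_for (fock_shift n H) (carrier M))
    (invN : invariant_for (fock_shift n H) (carrier N))
    (noredM : contains_no_reducing (fock_shift n H) (carrier M))
    (noredN : contains_no_reducing (fock_shift n H) (carrier N))
    (posM : positive_op (defect (fock_shift n H) (orth_proj M)))
    (posN : positive_op (defect (fock_shift n H) (orth_proj N)))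
    (rankM : finite_rank (defect (fock_shift n H) (orth_proj M)))
    (rankN : finite_rank (defect (fock_shift n H) (orth_proj N))) :
  unitarily_equivalent invM invN <->
  euler_characteristic (restrict_tuple invM)
    = euler_characteristic (restrict_tuple invN).
Proof.
have Sri := fock_row_isometries n H.
apply: intertwined_iff_euler.
- exact: restrict_row_isometries.
- exact: restrict_row_isometries.
- exact: restrict_doubly_commuting.
- exact: restrict_doubly_commuting.
- exact: restrict_completely_pure.
- exact: restrict_completely_pure.
- exact: finite_rank_restrict.
- exact: finite_rank_restrict.
Qed.
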